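(* There is a KMS$_{\ln d}$ state $\psi$ on $(\mathcal{O}(G,P),\alpha)$ such that \[ \psi(\bar T_x\bar T_y^* )=\delta_{x,y}\,e^{-(\ln d)\theta(x)}=\delta_{x,y}\,d^{-\theta(x)}\quad\text{for all }x,y\in P. \] If $d$ does not divide $c$, then this is the only KMS state (at any inverse temperature) on $(\mathcal{O}(G,P),\alpha)$.
   Context: Fix positive integers $c,d$. $G=\mathrm{BS}(c,d)=\langle a,b: ab^c=b^da\rangle$ is the Baumslag-Solitar group, $P$ is the submonoid of $G$ generated by $a$ and $b$, and $\theta:G\to\mathbb{Z}$ is the homomorphism with $\theta(a)=1$, $\theta(b)=0$. Order: for $g,h\in G$, $g\leq h$ means $g^{-1}h\in P$. It is known (Spielberg) that $(G,P)$ is quasi-lattice ordered: $P\cap P^{-1}=\{e\}$, and every pair $g,h\in G$ with a common upper bound in $P$ has a least upper bound $g\vee h$ in $P$. Write $g\vee h<\infty$ if a common upper bound in $P$ exists and $g\vee h=\infty$ otherwise. A Nica-covariant representation of $P$ is a map $x\mapsto S_x$ of $P$ into the isometries of a unital $C^*$-algebra with $S_e=1$, $S_xS_y=S_{xy}$, and $S_xS_x^*S_yS_y^*=S_{x\vee y}S_{x\vee y}^*$ if $x\vee y<\infty$ and $=0$ if $x\vee y=\infty$. $C^*(G,P)$ is the $C^*$-algebra generated by a universal Nica-covariant representation $T:P\to C^*(G,P)$; it is the closed linear span of $\{T_xT_y^*:x,y\in P\}$. $I$ is the (closed two-sided) ideal of $C^*(G,P)$ generated by $1-\sum_{j=0}^{d-1}T_{b^ja}T_{b^ja}^*$,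 $\mathcal{O}(G,P):=C^*(G,P)/I$, and $\bar T_x$ is the image of $T_x$ in $\mathcal{O}(G,P)$. The dynamics $\alpha:\mathbb{R}\to\mathrm{Aut}\,C^*(G,P)$ with $\alpha_t(T_x)=e^{it\theta(x)}T_x$ induces a dynamics, also denoted $\alpha$, on $\mathcal{O}(G,P)$. For $\beta\in\mathbb{R}$, a state $\psi$ of $\mathcal{O}(G,P)$ is a KMS$_\beta$ state if and only if $\psi((\bar T_x\bar T_y^* )(\bar T_p\bar T_q^* ))=e^{-\beta(\theta(x)-\theta(y))}\psi((\bar T_p\bar T_q^* )(\bar T_x\bar T_y^* ))$ for all $x,y,p,q\in P$ and, when $\beta=0$, $\psi$ is in addition $\alpha$-invariant. *)

(* Defs.v *)
From HB Require Import structures.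
From mathcomp Require Import all_boot all_order all_algebra.
From mathcomp Require Import generic_quotient complex.
From mathcomp Require Import all_classical all_reals all_analysis.

Set Implicit Arguments.
Unset Strict Implicit.
Unset Printing Implicit Defensive.

Import Order.TTheory GRing.Theory Num.Theory.
Import numFieldNormedType.Exports.

Local Open Scope quotient_scope.
Local Open Scope ring_scope.
Local Open Scope complex_scope.

(* In a letter (g, e), the flag g selects the generator (true for a, false    *)
(* for b) and e tells whether it is inverted.                                 *)
Definition letter : Type := (bool * bool)%type.
Definition word := seq letter.

Definition letter_a : letter := (true, false).
Definition letter_b : letter := (false, false).
Definition letterV (l : letter) : letter := (l.1, ~~ l.2).
Definition wordV (w : word) : word := rev (map letterV w).

Inductive BS_cong (c d : nat) : word -> word -> Prop :=
| BS_cong_refl w : BS_cong c d w w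
| BS_cong_sym u v : BS_cong c d u v -> BS_cong c d v u
| BS_cong_trans v u w : BS_cong c d u v -> BS_cong c d v w -> BS_cong c d u w
| BS_cong_cat u u' v v' :
    BS_cong c d u u' -> BS_cong c d v v' -> BS_cong c d (u ++ v) (u' ++ v')
| BS_cong_cancel l : BS_cong c d [:: l; letterV l] [::]
| BS_cong_rel :
    BS_cong c d (letter_a :: nseq c letter_b) (rcons (nseq d letter_b) letter_a).

Section BaumslagSolitar.
Variables c d : nat.

Definition BS_congb (u v : word) : bool := `[< BS_cong c d u v >].

Fact BS_congb_refl : reflexive BS_congb.
Proof. by move=> w; apply/asboolP; exact: BS_cong_refl. Qed.

Fact BS_congb_sym : symmetric BS_congb.
Proof. by move=> u v; apply/asboolP/asboolP; exact: BS_cong_sym. Qed.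

Fact BS_congb_trans : transitive BS_congb.
Proof.
move=> v u w /asboolP uv /asboolP vw; apply/asboolP.
exact: BS_cong_trans uv vw.
Qed.

Canonical BS_equiv := EquivRel BS_congb BS_congb_refl BS_congb_sym BS_congb_trans.

Definition BS : Type := {eq_quot BS_equiv}.
HB.instance Definition _ := Choice.on BS.
HB.instance Definition _ := EqQuotient.on BS.

Implicit Types x y z : BS.

Lemma BS_eqP (u v : word) : \pi_BS u = \pi_BS v <-> BS_cong c d u v.
Proof.
split; first by move/eqP; rewrite eqmodE => /asboolP.
by move=> uv; apply/eqP; rewrite eqmodE; apply/asboolP.
Qed.

Lemma BS_reprP (w : word) : BS_cong c d (repr (\pi_BS w)) w.
Proof. by apply/BS_eqP; rewrite reprK. Qed.

Definition BS_one : BS := \pi_BS [::].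
Definition BS_mul x y : BS := \pi_BS (repr x ++ repr y).
Definition BS_inv x : BS := \pi_BS (wordV (repr x)).

Lemma BS_mul_pi (u v : word) : BS_mul (\pi_BS u) (\pi_BS v) = \pi_BS (u ++ v).
Proof. by apply/BS_eqP/BS_cong_cat; exact: BS_reprP. Qed.

Fact BS_mulA : associative BS_mul.
Proof.
move=> x y z.
by rewrite -[x in LHS]reprK -[z in RHS]reprK !BS_mul_pi catA.
Qed.

Fact BS_mul1 : left_id BS_one BS_mul.
Proof. by move=> x; rewrite -(reprK x) BS_mul_pi. Qed.

Fact BS_mulr1 : right_id BS_one BS_mul.
Proof. by move=> x; rewrite -(reprK x) BS_mul_pi cats0. Qed.

Lemma letterVK : involutive letterV.
Proof. by case=> g e; rewrite /letterV /= negbK. Qed.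

Lemma wordVK : involutive wordV.
Proof. by move=> w; rewrite /wordV map_rev revK mapK //; exact: letterVK. Qed.

Lemma BS_cong_mulV (w : word) : BS_cong c d (w ++ wordV w) [::].
Proof.
elim: w => [|l w IHw]; first exact: BS_cong_refl.
have -> : (l :: w) ++ wordV (l :: w) = [:: l] ++ ((w ++ wordV w) ++ [:: letterV l]).
  by rewrite /wordV /= rev_cons -cats1 -!catA.
apply: (BS_cong_trans _ (BS_cong_cancel c d l)).
rewrite -[[:: l; letterV l]]/([:: l] ++ ([::] ++ [:: letterV l])).
apply: BS_cong_cat; first exact: BS_cong_refl.
by apply: BS_cong_cat => //; exact: BS_cong_refl.
Qed.

Fact BS_mulV : right_inverse BS_one BS_inv BS_mul.
Proof.
move=> x; rewrite -{1}(reprK x) /BS_inv BS_mul_pi.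
by apply/BS_eqP; exact: BS_cong_mulV.
Qed.

Fact BS_mulVl : left_inverse BS_one BS_inv BS_mul.
Proof.
move=> x; rewrite -{2}(reprK x) /BS_inv BS_mul_pi.
by apply/BS_eqP; rewrite -{2}(wordVK (repr x)); exact: BS_cong_mulV.
Qed.

HB.instance Definition _ :=
  isGroup.Build BS BS_mulA BS_mul1 BS_mulr1 BS_mulVl BS_mulV.

Definition BSa : BS := \pi_BS [:: letter_a].
Definition BSb : BS := \pi_BS [:: letter_b].

Lemma BSb_exp n : (BSb ^+ n)%g = \pi_BS (nseq n letter_b).
Proof.
elim: n => [|n IHn]; first by rewrite expg0.
by rewrite expgS IHn; exact: BS_mul_pi.
Qed.

Lemma BS_rel : (BSa * BSb ^+ c = BSb ^+ d * BSa)%g.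
Proof.
rewrite !BSb_exp [LHS]BS_mul_pi [RHS]BS_mul_pi cats1.
by apply/BS_eqP; exact: BS_cong_rel.
Qed.

Definition letter_theta (l : letter) : int :=
  if l.1 then (if l.2 then -1 else 1) else 0.
Definition word_theta (w : word) : int := \sum_(l <- w) letter_theta l.
Definition BS_theta x : int := word_theta (repr x).

Lemma word_theta_cong (u v : word) :
  BS_cong c d u v -> word_theta u = word_theta v.
Proof.
elim=> {u v} [//|u v _ -> //|v u w _ -> _ -> //|u u' v v' _ uu' _ vv'|[[] []]|].
- by rewrite /word_theta !big_cat /=; congr (_ + _).
- by rewrite /word_theta !big_cons big_nil.
- by rewrite /word_theta !big_cons big_nil.
- by rewrite /word_theta !big_cons big_nil.
- by rewrite /word_theta !big_cons big_nil.
- rewrite /word_theta -cats1 big_cons big_cat big_seq1 /=.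
  have b0 n : \sum_(l <- nseq n letter_b) letter_theta l = 0.
    by rewrite big_nseq; elim: n => //= n ->.
  by rewrite !b0 addr0 add0r.
Qed.

Lemma BS_theta_pi (w : word) : BS_theta (\pi_BS w) = word_theta w.
Proof. exact/word_theta_cong/BS_reprP. Qed.

Lemma BS_thetaM : {morph BS_theta : x y / (x * y)%g >-> x + y}.
Proof.
move=> x y; rewrite -(reprK x) -(reprK y).
have -> : (\pi_BS (repr x) * \pi_BS (repr y))%g = \pi_BS (repr x ++ repr y).
  exact: BS_mul_pi.
by rewrite !BS_theta_pi /word_theta big_cat.
Qed.

Lemma BS_theta_a : BS_theta BSa = 1.
Proof. by rewrite BS_theta_pi /word_theta big_seq1. Qed.

Lemma BS_theta_b : BS_theta BSb = 0.
Proof. by rewrite BS_theta_pi /word_theta big_seq1. Qed.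

Inductive BSpos : BS -> Prop :=
| BSpos1 : BSpos 1%g
| BSposa : BSpos BSa
| BSposb : BSpos BSb
| BSposM x y : BSpos x -> BSpos y -> BSpos (x * y)%g.

Definition BSle x y : Prop := BSpos (x^-1 * y)%g.

Definition BSub x y z : Prop := [/\ BSpos z, BSle x z & BSle y z].

Definition BSlub x y z : Prop :=
  BSub x y z /\ forall w, BSub x y w -> BSle z w.

End BaumslagSolitar.

Arguments BSpos {c d} x.
Arguments BS_theta {c d} x.
Arguments BSub {c d} x y z.
Arguments BSlub {c d} x y z.

(* Unital complex C*-algebras; norms of elements live in R[i]. The product is *)
(* part of the mixin because a structure joining CompleteNormedModule with    *)
(* PzRing would need a join below NumDomain that MathComp does not have; the  *)
(* pzRingType instance is recovered right below. Since 1 = 0 is allowed, a    *)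
(* quotient by a closed ideal is not assumed to be proper.                    *)
HB.mixin Record isCStarAlgebra (R : realType) A
    of CompleteNormedModule R[i] A := {
  cstar_one : A;
  cstar_mul : A -> A -> A;
  star : A -> A;
  cstar_mulA : associative cstar_mul;
  cstar_mul1l : left_id cstar_one cstar_mul;
  cstar_mul1r : right_id cstar_one cstar_mul;
  cstar_mulDl : left_distributive cstar_mul +%R;
  cstar_mulDr : right_distributive cstar_mul +%R;
  cstar_scaleAl : forall (k : R[i]) (x y : A),
    k *: cstar_mul x y = cstar_mul (k *: x) y;
  cstar_scaleAr : forall (k : R[i]) (x y : A),
    k *: cstar_mul x y = cstar_mul x (k *: y);
  starK : involutive star;
  starD : forall x y : A, star (x + y) = star x + star y;
  starZ : forall (k : R[i]) (x : A), star (k *: x) = k^* *: star x;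
  starM : forall x y : A, star (cstar_mul x y) = cstar_mul (star y) (star x);
  cstar_normM : forall x y : A, `|cstar_mul x y| <= `|x| * `|y|;
  cstar_normE : forall x : A, `|cstar_mul (star x) x| = `|x| ^+ 2
}.

#[short(type="cstarType")]
HB.structure Definition CStarAlgebra (R : realType) :=
  {A of isCStarAlgebra R A & CompleteNormedModule R[i] A}.

HB.instance Definition _ (R : realType) (A : cstarType R) :=
  GRing.Zmodule_isPzRing.Build A (@cstar_mulA R A) (@cstar_mul1l R A)
    (@cstar_mul1r R A) (@cstar_mulDl R A) (@cstar_mulDr R A).

Definition star_hom (R : realType) (A B : cstarType R) (f : A -> B) : Prop :=
  [/\ linear f, f 1 = 1, {morph f : x y / x * y} & {morph f : x / star x}].

Definition closed_star_subalgebra (R : realType) (A : cstarType R) (D : set A)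
    : Prop :=
  [/\ D 1, forall (k : R[i]) x y, D x -> D y -> D (k *: x + y),
      forall x y, D x -> D y -> D (x * y), forall x, D x -> D (star x)
    & closed D].

Definition closed_ideal (R : realType) (A : cstarType R) (J : set A) : Prop :=
  [/\ J 0, forall (k : R[i]) x y, J x -> J y -> J (k *: x + y),
      forall x y, J y -> J (x * y), forall x y, J x -> J (x * y) & closed J].

Definition generated_ideal (R : realType) (A : cstarType R) (u : A) : set A :=
  [set z | forall J : set A, closed_ideal J -> J u -> J z]%classic.

(* A C*-algebra O with an onto *-homomorphism q : A -> O of kernel J is       *)
(* the quotient A / J, up to isometric *-isomorphism.                         *)
Definition is_quotient (R : realType) (A O : cstarType R) (J : set A)
    (q : A -> O) : Prop :=
  [/\ star_hom q, forall y, exists x, q x = y & forall x, q x = 0 <-> J x].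

Definition is_state (R : realType) (A : cstarType R) (psi : A -> R[i]) : Prop :=
  [/\ scalar psi, forall x, 0 <= psi (star x * x) & psi 1 = 1].

Definition is_dynamics (R : realType) (A : cstarType R) (alpha : R -> A -> A)
    : Prop :=
  [/\ forall t, star_hom (alpha t), forall x, alpha 0 x = x,
      forall s t x, alpha (s + t) x = alpha s (alpha t x)
    & forall x, continuous (fun t : R => alpha t x)].

(* Maps out of P are represented by maps out of the whole group whose values  *)
(* outside P are irrelevant.                                                  *)
Definition nica_covariant (R : realType) (c d : nat) (A : cstarType R)
    (S : BS c d -> A) : Prop :=
  [/\ forall x, BSpos x -> star (S x) * S x = 1,
      S 1%g = 1,
      forall x y, BSpos x -> BSpos y -> S (x * y)%g = S x * S y,
      forall x y z, BSpos x -> BSpos y -> BSlub x y z ->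
        S x * star (S x) * (S y * star (S y)) = S z * star (S z)
    & forall x y, BSpos x -> BSpos y -> ~ (exists z, BSub x y z) ->
        S x * star (S x) * (S y * star (S y)) = 0].

(* (A, T) is C*(G,P) with its canonical representation.                       *)
Definition universal_nica (R : realType) (c d : nat) (A : cstarType R)
    (T : BS c d -> A) : Prop :=
  [/\ nica_covariant T,
      forall D : set A, closed_star_subalgebra D ->
        (forall x, BSpos x -> D (T x)) -> forall z, D z
    & forall (B : cstarType R) (S : BS c d -> B), nica_covariant S ->
        exists2 f : A -> B, star_hom f & forall x, BSpos x -> f (T x) = S x].

Definition cuntz_defect (R : realType) (c d : nat) (A : cstarType R)
    (T : BS c d -> A) : A :=
  1 - \sum_(j < d) T (BSb c d ^+ j * BSa c d)%g
                   * star (T (BSb c d ^+ j * BSa c d)%g).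

Definition is_gauge_dynamics (R : realType) (c d : nat) (A : cstarType R)
    (T : BS c d -> A) (alpha : R -> A -> A) : Prop :=
  is_dynamics alpha /\
  forall (t : R) x, BSpos x ->
    alpha t (T x) = (cos (t * (BS_theta x)%:~R) +i* sin (t * (BS_theta x)%:~R)) *: T x.

(* KMS states at beta for a dynamics scaling Tb x by exp(i t theta(x)),       *)
(* where the Tb x * star (Tb y) span a dense subspace.                        *)
Definition is_KMS (R : realType) (c d : nat) (O : cstarType R)
    (Tb : BS c d -> O) (alpha : R -> O -> O) (beta : R) (psi : O -> R[i])
    : Prop :=
  [/\ is_state psi,
      forall x y p q, BSpos x -> BSpos y -> BSpos p -> BSpos q ->
        psi ((Tb x * star (Tb y)) * (Tb p * star (Tb q))) =
        (expR (- beta * (BS_theta x - BS_theta y)%:~R))%:C *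
        psi ((Tb p * star (Tb q)) * (Tb x * star (Tb y)))
    & beta = 0 -> forall t z, psi (alpha t z) = psi z].

(* Main.v *)
Require Import Defs.
From HB Require Import structures.
From mathcomp Require Import all_boot all_order all_algebra finmap.
From mathcomp Require Import generic_quotient complex.
From mathcomp Require Import all_classical all_reals all_analysis.
From mathcomp.analysis Require Import showcase.summability.
From mathcomp Require Import ring lra zify.

Set Implicit Arguments.
Unset Strict Implicit.
Unset Printing Implicit Defensive.

Import Order.TTheory GRing.Theory Num.Theory.
Import numFieldNormedType.Exports.

Local Open Scope ring_scope.
Local Open Scope complex_scope.

(** The number d^-theta(x) is a density. Let P act by injections on a set X
    (here Z x N) such that b acts as a bijection and X is the disjoint union of
    the b^j a X with j < d. Letting G also translate itself, P acts on X x G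
    and hence by isometries on l2(X x G). Any two of the sets xX are nested or
    disjoint, according to whether x and y have a common upper bound
    [BSpos_nested]; this makes the representation Nica covariant [rep_nica],
    and the partition of X makes it kill the generator of the ideal
    [rep_cuntz]. In the vector state at (u, 1) the factor G leaves only x = y,
    where T_x T_y^* contributes the indicator of xX at u. In a large box of X
    the set xX has density exactly d^-theta(x) [count_box_normal_form], so the
    averages of these vector states over boxes have the required limit
    [model_state]. The representation is continuous, because a positive
    functional on a C*-algebra is [pos_functional_bound]; so it kills the whole
    ideal and the limit state descends to the quotient [quotient_state].

    In the quotient the product T_y^* T_p is always 0 or T_r T_s^* for some
    common upper bound yr = ps [wickP]: the partition of unity gives it for
    y a power of b and p = a, and then it propagates to all words. Hence the
    T_x T_y^* together with the kernel span a dense subspace of C*(G,P), states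
    are determined by their values on them [quotient_state_ext], and the KMS
    condition of the state above becomes a computation in G [psi_KMS].

    Conversely let phi be a KMS state. The d range projections of the T_(b^j a)
    have mass e^-beta each and sum to 1, so beta = ln d [KMS_beta]. The KMS
    condition and the rule for T_y^* T_x reduce the values of phi on monomials
    to the numbers phi(T_b^m), and inserting the partition of unity shows that
    phi(T_b^m) is phi(T_b^(cm/d)) if d divides m and 0 otherwise
    [phi_bX_step]. When d does not divide c, iterating m |-> cm/d must leave the
    integers, so phi(T_b^m) = 0 for all m > 0 [phi_bX] and phi has the
    prescribed values. *)

(** * C*-algebras: norm, square roots and positive functionals *)

Section ComplexParts.
Variable R : realType.
Implicit Types z w : R[i].

Lemma ReD z w : complex.Re (z + w) = complex.Re z + complex.Re w.
Proof. by case: z w => [? ?] [? ?]. Qed.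

Lemma ImD z w : complex.Im (z + w) = complex.Im z + complex.Im w.
Proof. by case: z w => [? ?] [? ?]. Qed.

Lemma ReB z w : complex.Re (z - w) = complex.Re z - complex.Re w.
Proof. by case: z w => [? ?] [? ?]. Qed.

Lemma ImB z w : complex.Im (z - w) = complex.Im z - complex.Im w.
Proof. by case: z w => [? ?] [? ?]. Qed.

Lemma ReM z w : complex.Re (z * w) =
  complex.Re z * complex.Re w - complex.Im z * complex.Im w.
Proof. by case: z w => [? ?] [? ?]. Qed.

Lemma ImM z w : complex.Im (z * w) =
  complex.Re z * complex.Im w + complex.Im z * complex.Re w.
Proof. by case: z w => [? ?] [? ?]. Qed.

End ComplexParts.

Section CStarNorm.
Local Open Scope classical_set_scope.
Variables (R : realType) (A : cstarType R).
Implicit Types (x y z : A) (k : R[i]).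

(** The norm of a C*-algebra takes its values in R[i]; order arguments are
    made with the same number read in R. *)
Definition nrm x : R := complex.Re `|x|.

Lemma nrmE x : `|x| = (nrm x)%:C.
Proof. by rewrite /nrm RRe_real// ger0_real// normr_ge0. Qed.

Lemma nrm_ge0 x : 0 <= nrm x.
Proof. by rewrite -ler0c -nrmE. Qed.

Lemma nrmD x y : nrm (x + y) <= nrm x + nrm y.
Proof. by rewrite -lecR rmorphD/= -!nrmE ler_normD. Qed.

Lemma nrmN x : nrm (- x) = nrm x.
Proof. by rewrite /nrm normrN. Qed.

Lemma nrmZr (r : R) x : nrm (r%:C *: x) = `|r| * nrm x.
Proof.
apply: complexI; rewrite rmorphM/= -!nrmE normrZ; congr (_ * _).
by rewrite normc_def/= expr0n/= addr0 sqrtr_sqr.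
Qed.

Lemma nrmM x y : nrm (x * y) <= nrm x * nrm y.
Proof. by rewrite -lecR rmorphM/= -!nrmE; exact: cstar_normM. Qed.

Lemma nrm_starM x : nrm (star x * x) = nrm x ^+ 2.
Proof. by apply: complexI; rewrite rmorphXn/= -!nrmE; exact: cstar_normE. Qed.

Lemma nrm0_eq0 x : nrm x = 0 -> x = 0.
Proof. by move=> x0; apply/normr0_eq0; rewrite nrmE x0. Qed.

Lemma nrm0 : nrm 0 = 0.
Proof. by rewrite /nrm normr0. Qed.

Lemma nrm_star x : nrm (star x) = nrm x.
Proof.
have le y : nrm y <= nrm (star y).
  have [->|y0] := eqVneq (nrm y) 0; first exact: nrm_ge0.
  have y_gt0 : 0 < nrm y by rewrite lt_def y0 nrm_ge0.
  by rewrite -(ler_pM2r y_gt0) -expr2 -nrm_starM nrmM.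
by apply/eqP; rewrite eq_le le -{2}(starK x) le.
Qed.

Lemma starB : {morph (@star R A) : x y / x - y}.
Proof.
move=> x y; rewrite starD; congr (_ + _).
by rewrite -scaleN1r starZ rmorphN rmorph1 scaleN1r.
Qed.

Lemma star_mul x y : star (x * y) = star y * star x.
Proof. exact: starM. Qed.

Lemma star1 : star 1 = 1 :> A.
Proof. by rewrite -[LHS]mulr1 -{2}(starK 1) -star_mul mulr1 starK. Qed.

Lemma star_scalerAl k x y : k *: (x * y) = k *: x * y.
Proof. exact: cstar_scaleAl. Qed.

Lemma star_scalerAr k x y : k *: (x * y) = x * (k *: y).
Proof. exact: cstar_scaleAr. Qed.

Lemma nrm_cvg_geom (u : nat -> A) (s : R) : 0 <= s -> s < 1 ->
  (forall n, nrm (u n.+1 - u n) <= s ^+ n) ->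
  exists y, forall e : R, 0 < e -> \forall n \near \oo, nrm (y - u n) < e.
Proof.
move=> s0 s1 us.
have s1' : 0 < 1 - s by rewrite subr_gt0.
have dist n m : nrm (u (n + m)%N - u n) <= s ^+ n / (1 - s).
  suff : nrm (u (n + m)%N - u n) * (1 - s) <= s ^+ n - s ^+ (n + m).
    move=> h; rewrite ler_pdivlMr// (le_trans h)// gerBl exprn_ge0//.
  elim: m => [|m IH]; first by rewrite addn0 !subrr nrm0 mul0r.
  have := nrmD (u (n + m).+1 - u (n + m)%N) (u (n + m)%N - u n).
  rewrite addrA subrK addnS => h.
  rewrite (le_trans (ler_wpM2r (ltW s1') h))// mulrDl.
  have := ler_wpM2r (ltW s1') (us (n + m)%N); rewrite exprS mulrBr mulr1.
  by move: IH; lra.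
have sn0 (e : R) : 0 < e -> \forall n \near \oo, s ^+ n / (1 - s) < e.
  move=> e0; have : (fun n => s ^+ n) @ \oo --> (0 : R).
    by apply: cvg_expr; rewrite ger0_norm.
  move/cvgr0Pnorm_lt => /(_ (e * (1 - s))) h.
  apply: filterS (h _); last by rewrite mulr_gt0.
  by move=> n /=; rewrite ltr_pdivrMr// ger0_norm ?exprn_ge0.
have : cvg (u @ \oo).
  apply: cauchy_cvg; apply/cauchy_exP => e e0.
  have eE : e = (complex.Re e)%:C by rewrite RRe_real// gtr0_real.
  rewrite eE ltcR in e0; have [N _ /(_ N) HN] := sn0 _ e0.
  exists (u N); exists N => // n Nn /=.
  rewrite -ball_normE/= eE -normrN opprB nrmE ltcR -(subnKC Nn).
  by apply: le_lt_trans (dist _ _) _; apply: HN => /=.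
move=> /cvg_ex[y uy]; exists y => e e0.
have /cvgrPdist_lt/(_ e%:C) := uy; rewrite ltcR => /(_ e0).
by apply: filterS => n; rewrite nrmE ltcR.
Qed.

(** The map y |-> (a + y^2) / 2 contracts the ball of radius |a| < 1, and a
    fixed point y of it satisfies (1 - y)^2 = 1 - a. It is self-adjoint because
    its adjoint is a fixed point in the same ball. *)
Lemma sqrt_one_sub (a : A) : star a = a -> nrm a < 1 ->
  exists2 y, star y = y & 1 - a = star y * y.
Proof.
move=> aa; set s := nrm a => s1.
have s0 : 0 <= s by exact: nrm_ge0.
pose F y := ((2^-1 : R)%:C) *: (a + y * y).
have half0 : 0 <= (2^-1 : R) by rewrite invr_ge0.
have Fball y : nrm y <= s -> nrm (F y) <= s.
  move=> ys; rewrite /F nrmZr ger0_norm//.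
  have h1 : nrm (y * y) <= s.
    apply: le_trans (nrmM y y) _.
    have := ler_pM (nrm_ge0 y) (nrm_ge0 y) ys ys; move: (nrm_ge0 y) s0 s1; nra.
  by have := nrmD a (y * y); rewrite -/s; lra.
have Flip y z : nrm y <= s -> nrm z <= s -> nrm (F y - F z) <= s * nrm (y - z).
  move=> ys zs; rewrite /F -scalerBr nrmZr ger0_norm//.
  have -> : a + y * y - (a + z * z) = y * (y - z) + (y - z) * z.
    by rewrite mulrBr mulrBl opprD addrACA subrr add0r addrA subrK.
  have h1 := nrmM y (y - z); have h2 := nrmM (y - z) z.
  have h3 := nrmD (y * (y - z)) ((y - z) * z).
  have h4 := ler_wpM2r (nrm_ge0 (y - z)) ys.
  have h5 := ler_wpM2l (nrm_ge0 (y - z)) zs.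
  lra.
pose u n := iter n F 0.
have us n : nrm (u n) <= s by elim: n => [|n IH]; [rewrite nrm0 | exact: Fball].
have du n : nrm (u n.+1 - u n) <= s ^+ n.
  elim: n => [|n IH]; last first.
    by apply: le_trans (Flip (u n.+1) (u n) (us _) (us _)) _; rewrite exprS ler_wpM2l.
  by rewrite subr0 (le_trans (us 1%N))// ltW.
have [y uy] := nrm_cvg_geom s0 s1 du.
have ys : nrm y <= s.
  apply/ler_addgt0Pr => e e0; have [N _ /(_ N (leqnn N)) /= h] := uy _ e0.
  by have := nrmD (y - u N) (u N); rewrite subrK; move: (us N); lra.
have yF : y = F y.
  apply/eqP; rewrite -subr_eq0; apply/eqP/nrm0_eq0/eqP.
  rewrite eq_le nrm_ge0 andbT; apply/ler_addgt0Pr => e e0; rewrite add0r.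
  have e20 : 0 < e / 2 by rewrite divr_gt0.
  have [N _ hN] := uy _ e20.
  have h1 := hN _ (leqnn N); have h2 := hN _ (leqnSn N); rewrite /= in h1 h2.
  have h3 := nrmD (y - u N.+1) (F (u N) - F y); rewrite addrA subrK in h3.
  have h4 := Flip _ _ (us N) ys; rewrite -(nrmN (u N - y)) opprB in h4.
  have : s * nrm (y - u N) <= nrm (y - u N) by rewrite ler_piMl ?nrm_ge0 ?ltW.
  lra.
have Fstar z : star (F z) = F (star z).
  rewrite /F starZ starD aa star_mul; congr (_ *: _).
  exact: conjc_real.
have yy : star y = y.
  have sys : nrm (star y) <= s by rewrite nrm_star.
  have := Flip _ _ sys ys; rewrite -Fstar -yF => h.
  apply/eqP; rewrite -subr_eq0; apply/eqP/nrm0_eq0.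
  by move: h s1 (nrm_ge0 (star y - y)); nra.
(* The fixed point equation reads (1 - y)^2 = 1 - a. *)
exists (1 - y); first by rewrite starB star1 yy.
rewrite starB star1 yy.
have -> : a = y + y - y * y.
  have : y + y = a + y * y.
    rewrite {1 2}yF /F -scalerDl -rmorphD/=.
    have -> : 2^-1 + 2^-1 = 1 :> R by lra.
    by rewrite scale1r.
  by move->; rewrite addrK.
by rewrite mulrBl mul1r mulrBr mulr1 !opprD !opprK !addrA.
Qed.

(** For K > |x|^2 the element K - star x x has the form star y y, whence
    rho (star x x) <= K rho 1. This is the source of the continuity of states
    and of representations. *)
Lemma pos_functional_bound (rho : A -> R) :
  {morph rho : x y / x - y} ->
  (forall (r : R) x, rho (r%:C *: x) = r * rho x) ->
  (forall x, 0 <= rho (star x * x)) ->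
  forall x, rho (star x * x) <= nrm x ^+ 2 * rho 1.
Proof.
move=> rhoB rhoZ rho0 x.
have rho1 : 0 <= rho 1 by rewrite -(mulr1 1) -{1}star1.
apply/ler_addgt0Pr => e e0.
(* The excess over |x|^2 costs at most e after multiplication by rho 1. *)
pose K := nrm x ^+ 2 + e / (rho 1 + 1).
have r1 : 0 < rho 1 + 1 by lra.
have d0 : 0 < e / (rho 1 + 1) by rewrite divr_gt0.
have K0 : 0 < K by rewrite /K; have := sqr_ge0 (nrm x); lra.
pose a := (K^-1)%:C *: (star x * x).
have [||y yy ay] := @sqrt_one_sub a.
- by rewrite /a starZ star_mul starK; congr (_ *: _); exact: conjc_real.
- rewrite /a nrmZr nrm_starM gtr0_norm ?invr_gt0// mulrC ltr_pdivrMr// mul1r.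
  by rewrite /K; lra.
have := rho0 y; rewrite -ay rhoB rhoZ subr_ge0 mulrC ler_pdivrMr// mulrC.
move=> h; apply: le_trans h _; rewrite /K mulrDl lerD2l.
rewrite -mulrA ler_piMr ?ltW// mulrC ltr_pdivrMr// mul1r ltrDl//.
Qed.

End CStarNorm.

(** * The Hilbert space of square summable families *)

(** The real part of z times the conjugate of w. For complex-linear operators
    adjoints may be computed with the real inner product, so that all limits
    below are limits of real numbers. *)
Definition rip (R : realType) (z w : R[i]) : R :=
  complex.Re z * complex.Re w + complex.Im z * complex.Im w.

Section RealInner.
Variable R : realType.
Implicit Types (z w k : R[i]) (r : R).

Lemma ripC z w : rip z w = rip w z.
Proof. by rewrite /rip; ring. Qed.

Lemma ripDl z z' w : rip (z + z') w = rip z w + rip z' w.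
Proof. by case: z z' w => [? ?] [? ?] [? ?]; rewrite /rip /=; ring. Qed.

Lemma ripZl r z w : rip (r%:C * z) w = r * rip z w.
Proof. by case: z w => [? ?] [? ?]; rewrite /rip /=; ring. Qed.

Lemma ripJl k z w : rip (k * z) w = rip z (k^* * w).
Proof. by case: k z w => [? ?] [? ?] [? ?]; rewrite /rip /=; ring. Qed.

Lemma rip_ge0 z : 0 <= rip z z.
Proof. by rewrite /rip addr_ge0// -expr2 sqr_ge0. Qed.

Lemma rip_eq0 z : rip z z = 0 -> z = 0.
Proof.
case: z => x y; rewrite /rip /= -!expr2 => /eqP.
by rewrite paddr_eq0 ?sqr_ge0// !sqrf_eq0 => /andP[/eqP -> /eqP ->].
Qed.

End RealInner.

Section SquareSummable.
Variables (R : realType) (E : choiceType).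

Local Open Scope classical_set_scope.
Implicit Types (u v w : E -> R[i]^o) (A B : {fset E}).

Definition pip A u v : R := \sum_(i <- A) rip (u i) (v i).

Lemma pipC A u v : pip A u v = pip A v u.
Proof. by apply: eq_bigr => i _; rewrite ripC. Qed.

Lemma pipDl A u u' v : pip A (u + u') v = pip A u v + pip A u' v.
Proof. by rewrite /pip -big_split/=; apply: eq_bigr => i _; exact: ripDl. Qed.

Lemma pipZl A (r : R) u v : pip A (r%:C *: u) v = r * pip A u v.
Proof. by rewrite /pip big_distrr/=; apply: eq_bigr => i _; exact: ripZl. Qed.

Lemma pipJl A (k : R[i]) u v : pip A (k *: u) v = pip A u (k^* *: v).
Proof. by apply: eq_bigr => i _; exact: ripJl. Qed.

Lemma pip_ge0 A u : 0 <= pip A u u.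
Proof. by apply: sumr_ge0 => i _; exact: rip_ge0. Qed.

Lemma pip_mono A B u : (A `<=` B)%fset -> pip A u u <= pip B u u.
Proof.
move=> AB; rewrite /pip [X in _ <= X](big_fsetID _ (mem A)) /= -[X in X <= _]addr0 lerD//.
  rewrite le_eqVlt; apply/orP; left; apply/eqP; apply: eq_fbigl => i.
  by rewrite !inE/=; case: (boolP (i \in A)) => [/(fsubsetP AB) ->|]; rewrite ?andbF.
by apply: sumr_ge0 => i _; exact: rip_ge0.
Qed.

Definition l2_pred : {pred E -> R[i]^o} :=
  fun u => `[< exists K, forall A, pip A u u <= K >].

Lemma l2_predP u :
  reflect (exists K, forall A, pip A u u <= K) (u \in l2_pred).
Proof. exact: asboolP. Qed.

Lemma l2_submod_closed : submod_closed l2_pred.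
Proof.
split; first by apply/l2_predP; exists 0 => A; rewrite /pip big1// => i _;
  rewrite /rip/= mul0r addr0.
move=> k u v /l2_predP[K uK] /l2_predP[L vL]; apply/l2_predP.
pose n : R := complex.Re k ^+ 2 + complex.Im k ^+ 2.
have n0 : 0 <= n by rewrite addr_ge0 ?sqr_ge0.
exists (2 * (n * K) + 2 * L) => A.
have h : pip A (k *: u + v) (k *: u + v) <= 2 * (n * pip A u u) + 2 * pip A v v.
  rewrite /pip !big_distrr/= -big_split; apply: ler_sum => i _ /=.
  rewrite !fctE /n.
  change (rip (k * u i + v i) (k * u i + v i) <=
    2 * ((complex.Re k ^+ 2 + complex.Im k ^+ 2) * rip (u i) (u i)) + 2 * rip (v i) (v i)).
  case: k {n n0} => a b; case: (u i) (v i) => [x y] [x' y']; rewrite /rip/=.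
  have := sqr_ge0 (a * x - b * y - x'); have := sqr_ge0 (a * y + b * x - y').
  by lra.
apply: le_trans h _; have := uK A; have := vL A.
by move=> ? ?; rewrite lerD// ler_pM2l// ler_wpM2l.
Qed.

HB.instance Definition _ :=
  GRing.isSubmodClosed.Build _ _ l2_pred l2_submod_closed.

Record l2 := L2 { l2v :> E -> R[i]^o; _ : l2v \in l2_pred }.
HB.instance Definition _ := [isSub for l2v].
HB.instance Definition _ := [Choice of l2 by <:].
HB.instance Definition _ := [SubChoice_isSubLmodule of l2 by <:].

End SquareSummable.
Arguments l2 : clear implicits.

Section InnerProduct.
Variables (R : realType) (E : choiceType).
Local Open Scope classical_set_scope.
Implicit Types (u v w x y : l2 R E) (A B : {fset E}).

#[local] Existing Instance totally_filter.

(** The sum over an arbitrary index set is a limit along the directed set of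
    its finite subsets. *)
Definition ip u v : R := lim (pip A u v @[A --> totally]).

Lemma totally_sub B : \forall A \near totally, (B `<=` A)%fset.
Proof. by exists B. Qed.

Lemma pip_cvg_self u : cvg (pip A u u @[A --> totally]).
Proof.
have /l2_predP[K uK] := valP u.
pose S := [set pip A u u | A in setT].
have ubS : ubound S K by move=> _ [A _ <-]; exact: uK.
have supS : has_sup S by split; [exists (pip fset0 u u), fset0 | exists K].
apply/cvg_ex; exists (sup S); apply/cvgrPdist_lt => e e0.
have [_ [A0 _ <-] hA0] := sup_adherent e0 supS.
apply: filterS (totally_sub A0) => A A0A.
have h1 : pip A u u <= sup S by apply: ub_le_sup; [case: supS | exists A].
have h2 : pip A0 u u <= pip A u u := pip_mono u A0A.
by rewrite ger0_norm ?subr_ge0//; lra.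
Qed.

Lemma pipDD A (u v : E -> R[i]^o) :
  pip A (u + v) (u + v) = pip A u u + 2 * pip A u v + pip A v v.
Proof.
have D (w : E -> R[i]^o) : pip A (u + v) w = pip A u w + pip A v w by exact: pipDl.
rewrite D (pipC A u) (pipC A v (u + v)) !D (pipC A v u).
by ring.
Qed.

Lemma pipN A (u v : E -> R[i]^o) : pip A (- u) v = - pip A u v.
Proof.
rewrite -[RHS]mulN1r -[RHS]pipZl; congr (pip A _ v).
by rewrite rmorphN rmorph1 scaleN1r.
Qed.

(** Polarization reduces this to u = v, where the partial sums increase and are
    bounded. *)
Lemma ip_cvg u v : pip A u v @[A --> totally] --> ip u v.
Proof.
suff : cvg (pip A u v @[A --> totally]) by [].
have -> : (fun A => pip A u v) =
    (fun A => 4^-1 * (pip A (l2v (u + v)) (l2v (u + v)) -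
                      pip A (l2v (u - v)) (l2v (u - v)))).
  apply/funext => A.
  have hp : pip A (l2v (u + v)) (l2v (u + v)) = _ := pipDD A u v.
  have hm : pip A (l2v (u - v)) (l2v (u - v)) = _ := pipDD A u (- l2v v).
  rewrite pipN (pipC A u) pipN (pipC A _ (- l2v v)) pipN (pipC A v u) in hm.
  by rewrite hp hm; field.
apply: is_cvgMr; apply: is_cvgB; first exact: (@pip_cvg_self (u + v)).
exact: (@pip_cvg_self (u - v)).
Qed.

#[local] Arguments ip_cvg : clear implicits.

Lemma ip_unique u v f (r : R) :
  (forall A, pip A u v = f A) -> f @ totally --> r -> ip u v = r.
Proof. by move=> /funext pf fr; rewrite /ip pf; exact: cvg_lim. Qed.

Lemma ipC u v : ip u v = ip v u.
Proof. by apply: ip_unique (ip_cvg v u) => A; rewrite pipC. Qed.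

Lemma ipDl u v w : ip (u + v) w = ip u w + ip v w.
Proof.
by apply: ip_unique (cvgD (ip_cvg u w) (ip_cvg v w)) => A; exact: pipDl.
Qed.

Lemma ipDr u v w : ip w (u + v) = ip w u + ip w v.
Proof. by rewrite ipC ipDl !(ipC w). Qed.

Lemma ipJl (k : R[i]) u v : ip (k *: u) v = ip u (k^* *: v).
Proof. by apply: ip_unique (ip_cvg u (k^* *: v)) => A; exact: pipJl. Qed.

Lemma ipZl (r : R) u v : ip (r%:C *: u) v = r * ip u v.
Proof. by apply: ip_unique (cvgM (cvg_cst r) (ip_cvg u v)) => A; exact: pipZl. Qed.

Lemma ipZr (r : R) u v : ip u (r%:C *: v) = r * ip u v.
Proof. by rewrite ipC ipZl ipC. Qed.

Lemma ipNl u v : ip (- u) v = - ip u v.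
Proof. by rewrite -scaleN1r -(rmorph1 (real_complex R)) -rmorphN ipZl mulN1r. Qed.

Lemma ipNr u v : ip u (- v) = - ip u v.
Proof. by rewrite ipC ipNl ipC. Qed.

Lemma pip_le_ip A u : pip A u u <= ip u u.
Proof.
apply: (cvgr_to_ge (ip_cvg u u)).
by apply: filterS (totally_sub A) => B; exact: pip_mono.
Qed.

Lemma ip_le u (K : R) : (forall A, pip A u u <= K) -> ip u u <= K.
Proof. by move=> h; apply: (cvgr_to_le (ip_cvg u u)); apply: nearW. Qed.

Lemma ip_ge0 u : 0 <= ip u u.
Proof. exact: le_trans (pip_ge0 fset0 u) (pip_le_ip _ _). Qed.

Lemma rip_le_ip u i : rip (u i) (u i) <= ip u u.
Proof. by have := pip_le_ip [fset i]%fset u; rewrite /pip big_seq_fset1. Qed.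

Lemma l2_ext u v : (forall i, u i = v i) -> u = v.
Proof. by move=> h; apply/val_inj/funext. Qed.

Lemma ip_eq0 u : ip u u = 0 -> u = 0.
Proof.
move=> u0; apply: l2_ext => i; apply: rip_eq0.
by apply/eqP; rewrite eq_le rip_ge0 andbT -u0 rip_le_ip.
Qed.

Lemma ip_inj u v : (forall w, ip u w = ip v w) -> u = v.
Proof.
move=> h; apply/eqP; rewrite -subr_eq0; apply/eqP/ip_eq0.
by rewrite [LHS]ipDl ipNl h subrr.
Qed.

Lemma ip0l u : ip 0 u = 0.
Proof. by have := ipDl 0 0 u; rewrite addr0; lra. Qed.

Lemma ip0r u : ip u 0 = 0.
Proof. by rewrite ipC ip0l. Qed.

Definition l2norm u : R := Num.sqrt (ip u u).

Lemma l2norm_ge0 u : 0 <= l2norm u. Proof. exact: sqrtr_ge0. Qed.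

Lemma l2norm_sqr u : l2norm u ^+ 2 = ip u u. Proof. by rewrite sqr_sqrtr// ip_ge0. Qed.

Lemma l2normZ (k : R[i]) u : l2norm (k *: u) = complex.Re `|k| * l2norm u.
Proof.
rewrite normc_def /= /l2norm -sqrtrM ?addr_ge0 ?sqr_ge0//; congr Num.sqrt.
rewrite ipJl scalerA.
have -> : k^* * k = (complex.Re k ^+ 2 + complex.Im k ^+ 2)%:C.
  case: k => a b; apply/eqP; rewrite eq_complex /=.
  by apply/andP; split; apply/eqP; ring.
exact: ipZr.
Qed.

Lemma l2norm_le u (K : R) : 0 <= K -> (l2norm u <= K) = (ip u u <= K ^+ 2).
Proof. by move=> K0; rewrite -l2norm_sqr ler_sqr ?nnegrE ?l2norm_ge0. Qed.

(** Cauchy-Schwarz, by expanding the square of |v| u - |u| v. *)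
Lemma ip_le_l2norm u v : ip u v <= l2norm u * l2norm v.
Proof.
have [v0|v0] := eqVneq (l2norm v) 0.
  have -> : v = 0 by apply: ip_eq0; rewrite -l2norm_sqr v0 expr0n.
  by rewrite ip0r mulr_ge0 ?l2norm_ge0.
have hv : 0 < l2norm v by rewrite lt_def v0 l2norm_ge0.
have [u0|u0] := eqVneq (l2norm u) 0.
  have -> : u = 0 by apply: ip_eq0; rewrite -l2norm_sqr u0 expr0n.
  by rewrite ip0l mulr_ge0 ?l2norm_ge0.
have hu : 0 < l2norm u by rewrite lt_def u0 l2norm_ge0.
have := ip_ge0 ((l2norm v)%:C *: u - (l2norm u)%:C *: v).
rewrite ipDl !ipDr !ipNl !ipNr !ipZl !ipZr -!l2norm_sqr (ipC v u).
have huv : 0 < l2norm u * l2norm v by rewrite mulr_gt0.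
move=> h; rewrite -subr_ge0 -(pmulr_rge0 _ huv).
by move: h; lra.
Qed.

Lemma l2normD u v : l2norm (u + v) <= l2norm u + l2norm v.
Proof.
rewrite l2norm_le ?addr_ge0 ?l2norm_ge0// ipDl !ipDr (ipC v u) -!l2norm_sqr.
by have := ip_le_l2norm u v; rewrite sqrrD; lra.
Qed.

Lemma l2normN u : l2norm (- u) = l2norm u.
Proof. by rewrite /l2norm ipNl ipNr opprK. Qed.

Lemma l2norm0 : l2norm 0 = 0.
Proof. by have := l2normZ 0 0; rewrite scaler0 normr0/= mul0r. Qed.

Lemma l2norm0_eq0 u : l2norm u = 0 -> u = 0.
Proof. by move=> u0; apply: ip_eq0; rewrite -l2norm_sqr u0 expr0n. Qed.

Lemma ip_norm_le u v : `|ip u v| <= l2norm u * l2norm v.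
Proof.
rewrite ler_norml ip_le_l2norm andbT.
by have := ip_le_l2norm (- u) v; rewrite ipNl l2normN; lra.
Qed.

Definition delta_fun (t : E) : E -> R[i]^o := fun i => (i == t)%:R.

Lemma pip_delta A (t : E) (u : E -> R[i]^o) :
  pip A u (delta_fun t) = if t \in A then complex.Re (u t) else 0.
Proof.
rewrite /pip; case: ifPn => tA; last first.
  rewrite big_seq big1// => i iA; rewrite /delta_fun.
  have -> : (i == t) = false by apply: contraNF tA => /eqP <-.
  by rewrite /rip/= !mulr0 addr0.
rewrite (big_fsetD1 t)//= big_seq big1 ?addr0.
  by rewrite /delta_fun eqxx /rip/= mulr1 mulr0 addr0.
move=> i; rewrite !inE => /andP[/negbTE it _]; rewrite /delta_fun it.
by rewrite /rip/= !mulr0 addr0.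
Qed.

Lemma delta_l2 t : delta_fun t \in @l2_pred R E.
Proof.
apply/l2_predP; exists 1 => A; rewrite pip_delta /delta_fun eqxx /=.
by case: ifP.
Qed.

Definition delta t : l2 R E := L2 (delta_l2 t).

Lemma ip_delta t u : ip u (delta t) = complex.Re (u t).
Proof.
apply: (ip_unique (fun=> erefl)); apply: cvg_near_cst.
apply: filterS (totally_sub [fset t]%fset) => A; rewrite fsub1set => tA.
by rewrite pip_delta tA.
Qed.

Lemma l2norm_delta t : l2norm (delta t) = 1.
Proof. by rewrite /l2norm ip_delta/= /delta_fun eqxx sqrtr1. Qed.

Lemma Im_ip_delta t u : complex.Im (u t) = ip u ('i *: delta t).
Proof.
have -> : 'i *: delta t = (- 'i)^* *: delta t.
  by congr (_ *: _); apply/eqP; rewrite eq_complex/= oppr0 opprK !eqxx.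
rewrite -ipJl ip_delta /=.
change (complex.Im (u t) = complex.Re (- 'i%C * u t)).
by case: (u t) => x y /=; ring.
Qed.

Lemma Re_coord_le t u : `|complex.Re (u t)| <= l2norm u.
Proof. by rewrite -ip_delta (le_trans (ip_norm_le _ _))// l2norm_delta mulr1. Qed.

Lemma Im_coord_le t u : `|complex.Im (u t)| <= l2norm u.
Proof.
rewrite Im_ip_delta (le_trans (ip_norm_le _ _))// l2normZ l2norm_delta mulr1.
by rewrite normc_def/= expr0n expr1n add0r sqrtr1 mulr1.
Qed.

End InnerProduct.
Arguments ip_cvg {R E} u v.

(** * The C*-algebra of bounded operators on it *)

Section BoundedOperators.
Variables (R : realType) (E : choiceType).
Local Notation H := (l2 R E).
Implicit Types (u v w : H) (f g : H -> H).

Definition is_adjoint f g : Prop := forall u v, ip (f u) v = ip u (g v).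

Lemma is_adjoint_sym f g : is_adjoint f g -> is_adjoint g f.
Proof. by move=> fg u v; rewrite ipC -fg ipC. Qed.

Lemma is_adjointB f g : is_adjoint f g -> {morph f : u v / u - v}.
Proof.
by move=> fg u v; apply: ip_inj => w; rewrite fg !ipDl !ipNl !fg.
Qed.

Lemma is_adjoint_scalable f g : is_adjoint f g ->
  (forall (k : R[i]) u, f (k *: u) = k *: f u) ->
  forall (k : R[i]) u, g (k *: u) = k *: g u.
Proof.
move=> fg fZ k u; apply: ip_inj => w.
by rewrite (is_adjoint_sym fg) ipJl -fZ -(is_adjoint_sym fg) -ipJl.
Qed.

Lemma is_adjoint_unique f g g' : is_adjoint f g -> is_adjoint f g' -> g = g'.
Proof.
move=> fg fg'; apply/funext => u; apply: ip_inj => w.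
by rewrite ipC -fg fg' ipC.
Qed.

Lemma is_adjoint_bounded f g (K : R) : 0 <= K -> is_adjoint f g ->
  (forall u, l2norm (f u) <= K * l2norm u) -> forall u, l2norm (g u) <= K * l2norm u.
Proof.
move=> K0 fg fK u; have [->|gu0] := eqVneq (l2norm (g u)) 0.
  by rewrite mulr_ge0// l2norm_ge0.
have gu : 0 < l2norm (g u) by rewrite lt_def gu0 l2norm_ge0.
rewrite -(ler_pM2r gu) -expr2 l2norm_sqr -fg (le_trans (ip_le_l2norm _ _))//.
by rewrite mulrAC ler_wpM2r ?l2norm_ge0.
Qed.

(** An adjoint forces additivity, but complex homogeneity is a separate
    requirement: complex conjugation has an adjoint for the real inner
    product. *)
Definition bop_spec f : Prop :=
  [/\ forall (k : R[i]) u, f (k *: u) = k *: f u,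
      exists K : R, 0 <= K /\ forall u, l2norm (f u) <= K * l2norm u
    & exists g, is_adjoint f g].

Definition bop_pred : {pred H -> H} := fun f => `[< bop_spec f >].

Lemma bop_submod_closed : submod_closed bop_pred.
Proof.
split.
  apply/asboolP; split; first by move=> k u; exact: esym (scaler0 _ _).
    by exists 0; split => // u; rewrite -[X in l2norm X]/(0 : H) l2norm0 mul0r.
  by exists 0 => u v; rewrite -[LHS]/(ip 0 v) -[RHS]/(ip u 0) ip0l ip0r.
move=> k f g /asboolP[fZ [K [K0 fK]] [f' ff']] /asboolP[gZ [L [L0 gL]] [g' gg']].
have k0 : 0 <= complex.Re `|k| by rewrite normc_def/= sqrtr_ge0.
apply/asboolP; split.
- move=> l u; rewrite -[LHS]/(k *: f (l *: u) + g (l *: u)) fZ gZ.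
  by rewrite -[RHS]/(l *: (k *: f u + g u)) scalerDr !scalerA mulrC.
- exists (complex.Re `|k| * K + L); split; first by rewrite addr_ge0// mulr_ge0.
  move=> u; apply: le_trans (l2normD _ _) _; rewrite mulrDl lerD// l2normZ -mulrA.
  by rewrite ler_wpM2l.
- exists (k^* *: f' + g') => u v.
  by rewrite [LHS]ipDl [RHS]ipDr ipJl ff' gg' (is_adjoint_scalable ff' fZ).
Qed.

HB.instance Definition _ :=
  GRing.isSubmodClosed.Build _ _ bop_pred bop_submod_closed.

Record bop := Bop { bopv :> H -> H; _ : bopv \in bop_pred }.
HB.instance Definition _ := [isSub for bopv].
HB.instance Definition _ := [Choice of bop by <:].
HB.instance Definition _ := [SubChoice_isSubLmodule of bop by <:].

Implicit Types (S T : bop).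

Lemma bopP T : bop_spec T.
Proof. by apply/asboolP; exact: (valP T). Qed.

Lemma bopZ T (k : R[i]) u : T (k *: u) = k *: T u.
Proof. by have [] := bopP T. Qed.

Lemma bopB T u v : T (u - v) = T u - T v.
Proof. by have [_ _ [g /is_adjointB]] := bopP T. Qed.

Lemma bop0 T : T 0 = 0.
Proof. by have := bopB T 0 0; rewrite !subrr. Qed.

Lemma bopD T u v : T (u + v) = T u + T v.
Proof. by rewrite -[v in LHS]opprK bopB -[- v]sub0r bopB bop0 sub0r opprK. Qed.

Lemma bop_ext S T : (forall u, S u = T u) -> S = T.
Proof. by move=> h; apply/val_inj/funext. Qed.

Local Open Scope classical_set_scope.

Definition opnorm T : R := inf [set K | 0 <= K /\ forall u, l2norm (T u) <= K * l2norm u].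

Lemma opnorm_le T (K : R) :
  0 <= K -> (forall u, l2norm (T u) <= K * l2norm u) -> opnorm T <= K.
Proof.
move=> K0 TK; apply: ge_inf; last by [].
by exists 0 => L [].
Qed.

Lemma opnorm_ge0 T : 0 <= opnorm T.
Proof.
by apply: lb_le_inf => [|K []//]; have [_ [K ?] _] := bopP T; exists K.
Qed.

Lemma l2norm_opnorm T u : l2norm (T u) <= opnorm T * l2norm u.
Proof.
have [_ [K [K0 TK]] _] := bopP T.
have [u0|u0] := eqVneq (l2norm u) 0.
  by rewrite (le_trans (TK u))// u0 !mulr0.
have u_gt0 : 0 < l2norm u by rewrite lt_def u0 l2norm_ge0.
rewrite -ler_pdivrMr//; apply: lb_le_inf; first by exists K.
by move=> L [_ TL]; rewrite ler_pdivrMr.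
Qed.

Lemma opnormD S T : opnorm (S + T) <= opnorm S + opnorm T.
Proof.
apply: opnorm_le => [|u]; first by rewrite addr_ge0// opnorm_ge0.
by rewrite mulrDl (le_trans (l2normD _ _))// lerD// l2norm_opnorm.
Qed.

Lemma opnormZ_le (k : R[i]) T : opnorm (k *: T) <= complex.Re `|k| * opnorm T.
Proof.
have k0 : 0 <= complex.Re `|k| by rewrite normc_def/= sqrtr_ge0.
apply: opnorm_le => [|u]; first by rewrite mulr_ge0// opnorm_ge0.
by rewrite -mulrA -[X in l2norm X]/(k *: T u) l2normZ ler_wpM2l// l2norm_opnorm.
Qed.

Lemma opnorm0_eq0 T : opnorm T = 0 -> T = 0.
Proof.
move=> T0; apply: bop_ext => u; apply/l2norm0_eq0/eqP.
by rewrite eq_le l2norm_ge0 andbT (le_trans (l2norm_opnorm T u))// T0 mul0r.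
Qed.

Definition bop_norm T : R[i] := (opnorm T)%:C.

Lemma bop_normD S T : bop_norm (S + T) <= bop_norm S + bop_norm T.
Proof. by rewrite /bop_norm -rmorphD lecR opnormD. Qed.

Lemma bop_normZ (k : R[i]) T : bop_norm (k *: T) = `|k| * bop_norm T.
Proof.
have le l S : bop_norm (l *: S) <= `|l| * bop_norm S.
  by rewrite -(RRe_real (ger0_real (normr_ge0 l))) -rmorphM lecR opnormZ_le.
have [->|k0] := eqVneq k 0.
  apply/eqP; rewrite eq_le le normr0 mul0r scale0r /bop_norm.
  by rewrite lecR opnorm_ge0.
apply/eqP; rewrite eq_le le/= -ler_pdivlMl ?normr_gt0//.
by rewrite -normfV -{1}[T](scalerK k0) le.
Qed.

Lemma bop_norm0_eq0 T : bop_norm T = 0 -> T = 0.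
Proof. by move=> /complexI; exact: opnorm0_eq0. Qed.

HB.instance Definition _ := Lmodule_isNormed.Build R[i] bop
  bop_normD bop_normZ bop_norm0_eq0.

Lemma bop_comp_subproof S T : (S \o T : H -> H) \in bop_pred.
Proof.
have [SZ [K [K0 SK]] [S' SS']] := bopP S.
have [TZ [L [L0 TL]] [T' TT']] := bopP T.
apply/asboolP; split.
- by move=> k u /=; rewrite TZ SZ.
- exists (K * L); split=> [|u]; first exact: mulr_ge0.
  by rewrite (le_trans (SK _))// -mulrA ler_wpM2l.
- by exists (T' \o S') => u v /=; rewrite SS' TT'.
Qed.
Definition bop_comp S T : bop := Bop (bop_comp_subproof S T).

Lemma bop_id_subproof : (id : H -> H) \in bop_pred.
Proof.
apply/asboolP; split=> //; last by exists id.
by exists 1; split=> // u; rewrite mul1r.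
Qed.
Definition bop_id : bop := Bop bop_id_subproof.

Lemma bop_adj_subproof T : exists T' : bop, is_adjoint T T'.
Proof.
have [TZ [K [K0 TK]] [g Tg]] := bopP T.
suff gb : g \in bop_pred by exists (Bop gb).
apply/asboolP; split; [exact: is_adjoint_scalable Tg TZ| |].
  by exists K; split=> //; exact: is_adjoint_bounded K0 Tg TK.
by exists T; exact: is_adjoint_sym.
Qed.
Definition bop_adj T : bop := sval (cid (bop_adj_subproof T)).

Lemma bop_adjP T : is_adjoint T (bop_adj T).
Proof. exact: (svalP (cid (bop_adj_subproof T))). Qed.

Lemma bop_adj_uniq T T' : is_adjoint T T' -> bop_adj T = T'.
Proof. by move=> h; apply/val_inj; exact: is_adjoint_unique (bop_adjP T) h. Qed.

Lemma bop_adjK : involutive bop_adj.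
Proof. by move=> T; apply/bop_adj_uniq/is_adjoint_sym/bop_adjP. Qed.

Lemma bop_adjD S T : bop_adj (S + T) = bop_adj S + bop_adj T.
Proof.
apply/bop_adj_uniq => u v.
by rewrite [LHS]ipDl !bop_adjP; exact: esym (ipDr _ _ _).
Qed.

Lemma bop_adjZ (k : R[i]) T : bop_adj (k *: T) = k^* *: bop_adj T.
Proof.
by apply/bop_adj_uniq => u v; rewrite [LHS]ipJl bop_adjP bopZ.
Qed.

Lemma bop_adjM S T : bop_adj (bop_comp S T) = bop_comp (bop_adj T) (bop_adj S).
Proof. by apply/bop_adj_uniq => u v /=; rewrite !bop_adjP. Qed.

Lemma opnorm_adj_le T : opnorm (bop_adj T) <= opnorm T.
Proof.
apply: opnorm_le => [|u]; first exact: opnorm_ge0.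
exact: is_adjoint_bounded (opnorm_ge0 T) (bop_adjP T) (l2norm_opnorm T) u.
Qed.

Lemma opnormM S T : opnorm (bop_comp S T) <= opnorm S * opnorm T.
Proof.
apply: opnorm_le => [|u /=]; first by rewrite mulr_ge0 ?opnorm_ge0.
by rewrite (le_trans (l2norm_opnorm _ _))// -mulrA ler_wpM2l ?opnorm_ge0 ?l2norm_opnorm.
Qed.

(** The C*-identity: <Tu, Tu> = <u, T^* T u> is at most |T^* T| |u|^2. *)
Lemma opnorm_adjM T : opnorm (bop_comp (bop_adj T) T) = opnorm T ^+ 2.
Proof.
apply/eqP; rewrite eq_le; apply/andP; split.
  apply: le_trans (opnormM _ _) _; rewrite expr2 ler_wpM2r ?opnorm_ge0//.
  exact: opnorm_adj_le.
set K := opnorm (bop_comp _ _); have K0 : 0 <= K by exact: opnorm_ge0.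
rewrite -(sqr_sqrtr K0) ler_sqr ?nnegrE ?opnorm_ge0 ?sqrtr_ge0//.
apply: opnorm_le => [|u]; first exact: sqrtr_ge0.
rewrite l2norm_le ?mulr_ge0 ?sqrtr_ge0 ?l2norm_ge0// exprMn sqr_sqrtr//.
rewrite bop_adjP (le_trans (ip_le_l2norm _ _))// expr2 mulrC mulrA.
by rewrite ler_wpM2r ?l2norm_ge0//; exact: (l2norm_opnorm (bop_comp (bop_adj T) T)).
Qed.

End BoundedOperators.

Section BopCStar.
Variables (R : realType) (E : choiceType).
Local Notation H := (l2 R E).
Local Notation bop := (bop R E).
Local Open Scope classical_set_scope.
Implicit Types (u v w : H) (S T : bop).

Lemma le_eps0 (x C : R) : 0 <= C ->
  (forall e : R, 0 < e -> x <= e * C) -> x <= 0.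
Proof.
move=> C0 h; apply/ler_addgt0Pr => e e0; rewrite add0r.
have C1 : 0 < C + 1 by lra.
have := h (e / (C + 1)); rewrite divr_gt0// => /(_ isT).
have : e / (C + 1) * C <= e; last by lra.
by rewrite mulrAC ler_pdivrMr// ler_wpM2l ?ltW//; lra.
Qed.

Lemma cvg_eqfl {I : Type} {F : set_system I} (f g : I -> R) (l l' : R) :
  f = g -> l = l' -> f @ F --> l -> g @ F --> l'.
Proof. by move=> -> ->. Qed.

(** The coordinates of g i u converge, and the Cauchy bound on finite partial
    sums of |g i u - g j u|^2 passes to the limit uniformly in u. The family is
    indexed by I so that the adjoints of a family can be handled along the same
    filter. *)
Lemma bop_pointwise_limit (I : Type) (F : set_system I) {FF : ProperFilter F}
    (g : I -> bop) :
  (forall e : R, 0 < e -> exists T0, \forall i \near F, opnorm (g i - T0) <= e) ->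
  exists L : H -> H, forall e : R, 0 < e ->
    \forall i \near F, forall u, l2norm (L u - g i u) <= e * l2norm u.
Proof.
move=> cF.
have lim_ex (phi : bop -> R) (C : R) : 0 <= C ->
    (forall S T, `|phi S - phi T| <= opnorm (T - S) * C) -> cvg (phi (g i) @[i --> F]).
  move=> C0 phiC; apply: cauchy_cvg; apply/cauchy_exP => e e0.
  have C1 : 0 < C + 1 by lra.
  have [T0 hT0] := cF (e / (C + 1)) (divr_gt0 e0 C1).
  exists (phi T0); apply: filterS hT0 => i hT; rewrite -ball_normE/=.
  apply: le_lt_trans (phiC _ _) _; apply: le_lt_trans (ler_wpM2r C0 hT) _.
  by rewrite mulrAC ltr_pdivrMr// ltr_pM2l//; lra.
pose re u t (T : bop) : R := complex.Re (T u t).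
pose im u t (T : bop) : R := complex.Im (T u t).
have subE S T u t : (T - S) u t = T u t - S u t by [].
have cre u t : cvg (re u t (g i) @[i --> F]).
  apply: (lim_ex _ (l2norm u) (l2norm_ge0 u)) => S T; rewrite distrC.
  apply: le_trans (l2norm_opnorm _ _); apply: le_trans (Re_coord_le t _).
  by rewrite subE /re; case: (S u t) (T u t) => [? ?] [? ?].
have cim u t : cvg (im u t (g i) @[i --> F]).
  apply: (lim_ex _ (l2norm u) (l2norm_ge0 u)) => S T; rewrite distrC.
  apply: le_trans (l2norm_opnorm _ _); apply: le_trans (Im_coord_le t _).
  by rewrite subE /im; case: (S u t) (T u t) => [? ?] [? ?].
pose L0 u : E -> R[i]^o := fun t =>
  lim (re u t (g i) @[i --> F]) +i* lim (im u t (g i) @[i --> F]).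
have pipL T0 (e : R) u : 0 <= e -> (\forall i \near F, opnorm (g i - T0) <= e) ->
    forall A, pip A (L0 u - l2v (T0 u)) (L0 u - l2v (T0 u)) <= (e * l2norm u) ^+ 2.
  move=> e0 hT0 A.
  have : pip A (l2v ((g i - T0) u)) (l2v ((g i - T0) u)) @[i --> F] -->
         pip A (L0 u - l2v (T0 u)) (L0 u - l2v (T0 u)).
    rewrite /pip; apply: cvg_big => [|t _]; first by move=> ?; exact: add_continuous.
    have hr : re u t (g i) - complex.Re (T0 u t) @[i --> F] -->
       lim (re u t (g i) @[i --> F]) - complex.Re (T0 u t).
      by apply: cvgB; [exact: cre|exact: cvg_cst].
    have hi : im u t (g i) - complex.Im (T0 u t) @[i --> F] -->
       lim (im u t (g i) @[i --> F]) - complex.Im (T0 u t).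
      by apply: cvgB; [exact: cim|exact: cvg_cst].
    apply: cvg_eqfl (cvgD (cvgM hr hr) (cvgM hi hi)).
      apply/funext => i; rewrite subE /rip /re /im /=.
      by rewrite !ReB !ImB.
    by rewrite !fctE /rip !ReB !ImB.
  move/cvgr_to_le; apply; apply: filterS hT0 => i hT.
  apply: le_trans (pip_le_ip _ _) _; rewrite -l2norm_le ?mulr_ge0 ?l2norm_ge0//.
  by rewrite (le_trans (l2norm_opnorm _ _))// ler_wpM2r ?l2norm_ge0.
have L0mem u : L0 u \in @l2_pred R E.
  have [T0 hT0] := cF 1 ltr01.
  rewrite -(subrK (l2v (T0 u)) (L0 u)); apply: rpredD; last exact: (valP (T0 u)).
  by apply/l2_predP; eexists => A; exact: pipL ler01 hT0 A.
exists (fun u => L2 (L0mem u)) => e e0.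
have e20 : 0 < e / 2 by rewrite divr_gt0.
have [T0 hT0] := cF _ e20.
apply: filterS (hT0) => i hT u; set T := g i in hT *.
have -> : L2 (L0mem u) - T u = (L2 (L0mem u) - T0 u) - (T - T0) u.
  by rewrite -[(T - T0) u]/(T u - T0 u) opprB addrA subrK.
rewrite (le_trans (l2normD _ _))// l2normN.
have h1 : l2norm ((T - T0) u) <= e / 2 * l2norm u.
  by rewrite (le_trans (l2norm_opnorm _ _))// ler_wpM2r ?l2norm_ge0.
have h2 : l2norm (L2 (L0mem u) - T0 u) <= e / 2 * l2norm u.
  rewrite l2norm_le ?mulr_ge0 ?l2norm_ge0 ?(ltW e0)//; apply: ip_le => A.
  exact: pipL (ltW e20) hT0 A.
rewrite {1}(splitr e) mulrDl; exact: (lerD h2 h1).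
Qed.

Lemma bop_complete (F : set_system bop) {FF : ProperFilter F} :
  cauchy F -> cvg F.
Proof.
move=> /cauchyP cF.
have {}cF (e : R) : 0 < e -> exists T0, \forall T \near F, opnorm (T - T0) <= e.
  move=> e0; have [|T0 hT0] := cF e%:C; first by rewrite ltcR.
  exists T0; apply: filterS hT0 => T; rewrite -ball_normE/= -normrN opprB ltcR.
  exact: ltW.
have cF' (e : R) : 0 < e ->
    exists T0, \forall T \near F, opnorm (bop_adj T - T0) <= e.
  move=> e0; have [T0 hT0] := cF _ e0; exists (bop_adj T0).
  apply: filterS hT0 => T hT; apply: le_trans hT.
  have -> : bop_adj T - bop_adj T0 = bop_adj (T - T0).
    by rewrite bop_adjD -[- T0]scaleN1r bop_adjZ rmorphN rmorph1 scaleN1r.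
  exact: opnorm_adj_le.
have [L hL] := @bop_pointwise_limit _ F _ id cF.
have [L' hL'] := bop_pointwise_limit cF'.
have Lmem : L \in @bop_pred R E.
  apply/asboolP; split.
  - move=> k u; apply/eqP; rewrite -subr_eq0; apply/eqP/l2norm0_eq0/eqP.
    rewrite eq_le l2norm_ge0 andbT.
    apply: (@le_eps0 _ (l2norm (k *: u) + complex.Re `|k| * l2norm u)).
      by rewrite addr_ge0 ?l2norm_ge0// mulr_ge0 ?l2norm_ge0// normc_def/= sqrtr_ge0.
    move=> e e0; have [T hT] := filter_ex (hL _ e0).
    have -> : L (k *: u) - k *: L u = (L (k *: u) - T (k *: u)) - k *: (L u - T u).
      by rewrite bopZ scalerBr opprB addrA subrK.
    rewrite (le_trans (l2normD _ _))// l2normN mulrDr lerD// l2normZ mulrCA ler_wpM2l//.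
    by rewrite normc_def/= sqrtr_ge0.
  - have [T hT] := filter_ex (hL _ ltr01); exists (1 + opnorm T).
    split=> [|u]; first by rewrite addr_ge0// opnorm_ge0.
    by rewrite -(subrK (T u) (L u)) (le_trans (l2normD _ _))// mulrDl lerD// l2norm_opnorm.
  - exists L' => u v; apply/eqP; rewrite -subr_eq0 -normr_le0.
    apply: (@le_eps0 _ (2 * (l2norm u * l2norm v))); first by rewrite !mulr_ge0 ?l2norm_ge0.
    move=> e e0; have [T [hT hT']] := filter_ex (filterI (hL _ e0) (hL' _ e0)).
    have -> : ip (L u) v - ip u (L' v) =
        ip (L u - T u) v - ip u (L' v - bop_adj T v).
      by rewrite ipDl ipDr ipNl ipNr bop_adjP; ring.
    rewrite (le_trans (ler_normB _ _))//.
    have h1 := ip_norm_le (L u - T u) v.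
    have h2 := ip_norm_le u (L' v - bop_adj T v).
    have h3 := ler_wpM2r (l2norm_ge0 v) (hT u).
    have h4 := ler_wpM2l (l2norm_ge0 u) (hT' v).
    lra.
apply/cvg_ex; exists (Bop Lmem); apply/cvgrPdist_le => e e0.
have eE : e = (complex.Re e)%:C by rewrite RRe_real// gtr0_real.
move: e0; rewrite eE ltcR => e0; apply: filterS (hL _ e0) => T hT.
rewrite lecR; apply: opnorm_le; first exact: ltW.
exact: hT.
Qed.

HB.instance Definition _ := Uniform_isComplete.Build bop (@bop_complete).

Lemma bop_compA : associative (@bop_comp R E).
Proof. by move=> S T U; exact: bop_ext. Qed.
Lemma bop_comp1l : left_id (bop_id R E) (@bop_comp R E).
Proof. by move=> T; exact: bop_ext. Qed.
Lemma bop_comp1r : right_id (bop_id R E) (@bop_comp R E).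
Proof. by move=> T; exact: bop_ext. Qed.
Lemma bop_compDl : left_distributive (@bop_comp R E) +%R.
Proof. by move=> S T U; exact: bop_ext. Qed.
Lemma bop_compDr : right_distributive (@bop_comp R E) +%R.
Proof. by move=> S T U; apply: bop_ext => u; exact: bopD. Qed.
Lemma bop_compZl (k : R[i]) S T : k *: bop_comp S T = bop_comp (k *: S) T.
Proof. exact: bop_ext. Qed.
Lemma bop_compZr (k : R[i]) S T : k *: bop_comp S T = bop_comp S (k *: T).
Proof. by apply: bop_ext => u; exact: (esym (bopZ S k (T u))). Qed.
Lemma bop_norm_comp S T : `|bop_comp S T| <= `|S| * `|T|.
Proof. by rewrite -rmorphM lecR opnormM. Qed.
Lemma bop_norm_adjM T : `|bop_comp (bop_adj T) T| = `|T| ^+ 2.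
Proof. by rewrite -[LHS]/((opnorm _)%:C) opnorm_adjM rmorphXn. Qed.

HB.instance Definition _ := isCStarAlgebra.Build R bop bop_compA bop_comp1l
  bop_comp1r bop_compDl bop_compDr bop_compZl bop_compZr (@bop_adjK R E)
  (@bop_adjD R E) (@bop_adjZ R E) (@bop_adjM R E) bop_norm_comp bop_norm_adjM.

End BopCStar.

(** * Operators induced by partial injections *)

Section PartialInjections.
Variables (R : realType) (E : choiceType).
Local Open Scope classical_set_scope.
Implicit Types (sg tau : E -> option E) (u v : l2 R E).
#[local] Existing Instance totally_filter.

Definition partial_inverse sg tau : Prop := forall s t, sg s = Some t <-> tau t = Some s.

Lemma partial_inverse_sym sg tau : partial_inverse sg tau -> partial_inverse tau sg.
Proof. by move=> h s t; split=> /h. Qed.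

Definition transport tau (u : E -> R[i]^o) : E -> R[i]^o :=
  fun t => if tau t is Some s then u s else 0.

Lemma rip0l (z : R[i]) : rip 0 z = 0.
Proof. by rewrite /rip/= !mul0r addr0. Qed.

Lemma rip0r (z : R[i]) : rip z 0 = 0.
Proof. by rewrite ripC rip0l. Qed.

Lemma pip_transport_le sg tau u (A : {fset E}) : partial_inverse sg tau ->
  pip A (transport tau u) (transport tau u) <= ip u u.
Proof.
move=> inv.
(* The partial inverse sg recovers t from tau t, whence no repetition. *)
have un : uniq (pmap tau A).
  apply: (@pmap_uniq _ _ _ (fun s => odflt s (sg s))) => [t|]; last exact: fset_uniq.
  by case E1 : (tau t) => [s|]//=; move/inv: E1 => ->.
have -> : pip A (transport tau u) (transport tau u) =
    pip [fset s in pmap tau A]%fset u u.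
  transitivity (\sum_(s <- pmap tau A) rip (u s) (u s)).
    rewrite /pip; elim: (enum_fset A) => [|t r IH] /=; first by rewrite !big_nil.
    rewrite big_cons IH /transport; case: (tau t) => [s|]/=; first by rewrite big_cons.
    by rewrite rip0l add0r.
  apply: perm_big; apply: uniq_perm => // s.
  by rewrite !inE.
exact: pip_le_ip.
Qed.

Lemma transport_mem sg tau u : partial_inverse sg tau -> transport tau u \in @l2_pred R E.
Proof.
move=> inv; apply/l2_predP; exists (ip u u) => A; exact: pip_transport_le.
Qed.
(** Both sides are sums over the pairs (s, t) matched by the injection with
    t in A0 or s in B0. Having arbitrarily large index sets on which the two
    partial sums agree is enough to compare the limits. *)
Lemma pip_transport sg tau (u v : E -> R[i]^o) (A0 B0 : {fset E}) : partial_inverse sg tau ->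
  pip (A0 `|` [fset t in pmap sg B0])%fset (transport tau u) v =
  pip (B0 `|` [fset s in pmap tau A0])%fset u (transport sg v).
Proof.
move=> inv.
pose F (p : E * E) := rip (u p.1) (v p.2).
pose ft t := omap (fun s => (s, t)) (tau t).
pose fs s := omap (fun t => (s, t)) (sg s).
have LE A : pip A (transport tau u) v = \sum_(p <- pmap ft A) F p.
  rewrite /pip; elim: (enum_fset A) => [|t r IH] /=; first by rewrite !big_nil.
  rewrite big_cons IH /transport /ft; case: (tau t) => [s|]/=; first by rewrite big_cons.
  by rewrite rip0l add0r.
have RE A : pip A u (transport sg v) = \sum_(p <- pmap fs A) F p.
  rewrite /pip; elim: (enum_fset A) => [|s r IH] /=; first by rewrite !big_nil.
  rewrite big_cons IH /transport /fs; case: (sg s) => [t|]/=; first by rewrite big_cons.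
  by rewrite rip0r add0r.
rewrite LE RE; apply: perm_big; apply: uniq_perm.
- apply: (@pmap_uniq _ _ _ (fun p => p.2)) => [t|]; last exact: fset_uniq.
  by rewrite /ft; case: (tau t).
- apply: (@pmap_uniq _ _ _ (fun p => p.1)) => [s|]; last exact: fset_uniq.
  by rewrite /fs; case: (sg s).
have ftP (A : {fset E}) s t : ((s, t) \in pmap ft A) = (t \in A) && (tau t == Some s).
  rewrite mem_pmap; apply/mapP/andP => [[t' t'A]|[tA /eqP ts]].
    by rewrite /ft; case E1 : (tau t') => [s'|]//= [-> ->]; rewrite E1 eqxx.
  by exists t => //; rewrite /ft ts.
have fsP (A : {fset E}) s t : ((s, t) \in pmap fs A) = (s \in A) && (sg s == Some t).
  rewrite mem_pmap; apply/mapP/andP => [[s' s'A]|[sA /eqP st]].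
    by rewrite /fs; case E1 : (sg s') => [t'|]//= [-> ->]; rewrite E1 eqxx.
  by exists s => //; rewrite /fs st.
have pmP (f : E -> option E) (A : {fset E}) t :
    (t \in pmap f A) = has (fun s => f s == Some t) A.
  rewrite mem_pmap; apply/mapP/hasP => [[s sA e]|[s sA /eqP e]].
    by exists s; rewrite // -e.
  by exists s; rewrite // -e.
move=> [s t]; rewrite ftP fsP.
have [ts|nts] := eqVneq (tau t) (Some s); last first.
  rewrite andbF; have [/inv st|] := eqVneq (sg s) (Some t); last by rewrite andbF.
  by rewrite st eqxx in nts.
have /inv st := ts; rewrite st eqxx !andbT !inE !pmP orbC; congr (_ || _).
  apply/hasP/idP => [[s' s'B /eqP/inv]|sB]; last by exists s; rewrite ?st.
  by rewrite ts => -[->].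
apply/idP/hasP => [tA|[t' t'A /eqP/inv]]; first by exists t; rewrite ?ts.
by rewrite st => -[->].
Qed.

Definition transport_l2 sg tau (inv : partial_inverse sg tau) u : l2 R E :=
  L2 (transport_mem u inv).

Lemma transport_adjoint sg tau (inv : partial_inverse sg tau) :
  is_adjoint (transport_l2 inv) (transport_l2 (partial_inverse_sym inv)).
Proof.
move=> u v; apply/eqP; rewrite -subr_eq0 -normr_le0.
apply/ler_addgt0Pr => e e0; rewrite add0r.
have e20 : 0 < e / 2 by rewrite divr_gt0.
have /cvgrPdist_lt/(_ _ e20) [A0 _ hA] := ip_cvg (transport_l2 inv u) v.
have /cvgrPdist_lt/(_ _ e20) [B0 _ hB] := ip_cvg u (transport_l2 (partial_inverse_sym inv) v).
have := hA _ (fsubsetUl A0 [fset t in pmap sg B0]%fset).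
have := hB _ (fsubsetUl B0 [fset s in pmap tau A0]%fset).
rewrite /= (pip_transport u v A0 B0 inv).
set x := ip _ _; set y := ip _ _; set p := pip _ _ _ => h1 h2.
have -> : y - x = (y - p) - (x - p) by rewrite opprB addrA subrK.
rewrite (le_trans (ler_normB _ _))// (splitr e).
exact: (lerD (ltW h2) (ltW h1)).
Qed.

Lemma transport_bop sg tau (inv : partial_inverse sg tau) : transport_l2 inv \in @bop_pred R E.
Proof.
apply/asboolP; split; last by exists (transport_l2 (partial_inverse_sym inv));
  exact: transport_adjoint.
  move=> k u; apply: l2_ext => t; rewrite -[RHS]/(k *: transport tau u t) /= /transport.
  by case: (tau t) => //; rewrite scaler0.
exists 1; split=> // u; rewrite mul1r l2norm_le ?l2norm_ge0// l2norm_sqr.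
by apply: ip_le => A; exact: pip_transport_le.
Qed.

Definition partial_isometry sg tau (inv : partial_inverse sg tau) : bop R E :=
  Bop (transport_bop inv).

Lemma partial_isometryE sg tau (inv : partial_inverse sg tau) u t :
  partial_isometry inv u t = if tau t is Some s then u s else 0.
Proof. by []. Qed.

Lemma star_partial_isometry sg tau (inv : partial_inverse sg tau) :
  star (partial_isometry inv) = partial_isometry (partial_inverse_sym inv).
Proof. exact/bop_adj_uniq/transport_adjoint. Qed.

End PartialInjections.

(** * An action of BS(c,d) on a model set *)

Section Model.
Variables c d : nat.
Hypotheses (hc : (0 < c)%N) (hd : (0 < d)%N).

Definition zquo (n : nat) (k : int) : int := (k %/ n%:Z)%Z.
Definition zrem (n : nat) (k : int) : nat := `|(k %% n%:Z)%Z|%N.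

Lemma zrem_lt n k : (0 < n)%N -> (zrem n k < n)%N.
Proof.
move=> n0; have nz : n%:Z != 0 by rewrite eqz_nat -lt0n.
by rewrite /zrem -ltz_nat gez0_abs ?modz_ge0// ltz_pmod// ltz_nat.
Qed.

Lemma zdivE n k : (0 < n)%N -> k = zquo n k * n%:Z + (zrem n k)%:Z.
Proof.
move=> n0; have nz : n%:Z != 0 by rewrite eqz_nat -lt0n.
by rewrite /zrem gez0_abs ?modz_ge0// -divz_eq.
Qed.

Lemma zquoD n m r : (r < n)%N -> zquo n (m * n%:Z + r%:Z) = m.
Proof.
move=> rn; rewrite /zquo divzMDl; last by rewrite eqz_nat -lt0n (leq_ltn_trans _ rn).
by rewrite divz_nat divn_small// addr0.
Qed.

Lemma zremD n m r : (r < n)%N -> zrem n (m * n%:Z + r%:Z) = r.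
Proof. by move=> rn; rewrite /zrem modzMDl modz_nat modn_small. Qed.

(** On Z x (N + N) the whole group acts; the monoid preserves the copy of Z x N
    given by the first summand, and the second summand makes room for inverse
    images. *)
Definition mpoint : Type := (int * (nat + nat))%type.
Implicit Types (p : mpoint) (g h x y z : BS c d).

(** The action of a. With first coordinate m c + r, the c copies of the first
    summand lying over m are merged into a single one over m d; the c copies of
    the second summand are spread over what remains between m d and m d + d - 1,
    namely the second summand d times and the first one d - 1 times. *)
Definition fwd_a p : mpoint :=
  let m := zquo c p.1 in let r := zrem c p.1 in
  match p.2 with
  | inl y => (m * d%:Z, inl (y * c + r)%N)
  | inr y => let N := (y * c + r)%N in
      let t := (N %/ (d + d.-1))%N in let i := (N %% (d + d.-1))%N in
      if (i < d)%N then (m * d%:Z + i%:Z, inr t)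
      else (m * d%:Z + (i - d).+1%:Z, inl t)
  end.

Definition bwd_a p : mpoint :=
  let m := zquo d p.1 in let j := zrem d p.1 in
  let from N := (m * c%:Z + (N %% c)%N%:Z, (N %/ c)%N) in
  match p.2 with
  | inl y => if j is j'.+1 then
               let q := from (y * (d + d.-1) + (d + j'))%N in (q.1, inr q.2)
             else let q := from y in (q.1, inl q.2)
  | inr y => let q := from (y * (d + d.-1) + j)%N in (q.1, inr q.2)
  end.

Lemma fwd_aK : cancel fwd_a bwd_a.
Proof.
case=> k [y|y]; rewrite /fwd_a /bwd_a /=.
  have r_lt := zrem_lt k hc; rewrite -[zquo c k * d%:Z]addr0 zremD// zquoD//=.
  by rewrite modnMDl modn_small// divnMDl// divn_small// addn0 -zdivE.
have r_lt := zrem_lt k hc; set N := (y * c + zrem c k)%N.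
have D0 : (0 < d + d.-1)%N by lia.
have iD := ltn_pmod N D0; have NE := divn_eq N (d + d.-1).
case: ifPn => i_lt /=.
  rewrite zremD// zquoD//= -NE /N modnMDl modn_small// divnMDl// divn_small//.
  by rewrite addn0 -zdivE.
have i_lt' : ((N %% (d + d.-1) - d).+1 < d)%N by lia.
rewrite zremD// zquoD//= (_ : d + (_ - d) = N %% (d + d.-1))%N; last by lia.
rewrite -NE /N modnMDl modn_small// divnMDl// divn_small//.
by rewrite addn0 -zdivE.
Qed.

Lemma bwd_aK : cancel bwd_a fwd_a.
Proof.
have D0 : (0 < d + d.-1)%N by lia.
case=> k [y|y]; rewrite /bwd_a /=; have j_lt := zrem_lt k hd; last first.
  rewrite /fwd_a /= zremD ?ltn_pmod// zquoD ?ltn_pmod// -divn_eq.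
  have jD : (zrem d k < d + d.-1)%N by lia.
  by rewrite modnMDl modn_small// divnMDl// divn_small// addn0 j_lt -zdivE.
case jE : (zrem d k) => [|j] /=; rewrite /fwd_a /= zremD ?ltn_pmod// zquoD ?ltn_pmod//.
  by rewrite -divn_eq [in RHS](zdivE k hd) jE addr0.
have jD : (d + j < d + d.-1)%N by lia.
rewrite -divn_eq modnMDl modn_small// divnMDl// divn_small// addn0.
by rewrite ltnNge leq_addr /= addKn -jE -zdivE.
Qed.

Definition shift_b (e : int) p : mpoint := (p.1 + e, p.2).

Definition act_letter (l : letter) p : mpoint :=
  match l with
  | (true, false) => fwd_a p
  | (true, true) => bwd_a p
  | (false, false) => shift_b 1 p
  | (false, true) => shift_b (-1) p
  end.

Definition act_word (w : word) p : mpoint := foldr act_letter p w.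

(** This is the relation a b^c = b^d a. *)
Lemma fwd_a_shift (k : int) (s : nat + nat) :
  fwd_a (k + c%:Z, s) = shift_b d%:Z (fwd_a (k, s)).
Proof.
have E : k + c%:Z = (zquo c k + 1) * c%:Z + (zrem c k)%:Z.
  by rewrite {1}(zdivE k hc) mulrDl mul1r addrAC.
have r_lt := zrem_lt k hc.
rewrite /fwd_a /shift_b /= E zquoD// zremD//.
case: s => y; first by rewrite mulrDl mul1r.
by case: ifP => _ /=; rewrite mulrDl mul1r addrAC.
Qed.

Lemma act_nseq_b n p : act_word (nseq n letter_b) p = shift_b n%:Z p.
Proof.
elim: n => [|n IH] /=; first by case: p => k y; rewrite /shift_b addr0.
rewrite IH /shift_b /=; congr (_, _); rewrite -addrA; congr (_ + _).
by rewrite -[n.+1]addn1 PoszD.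
Qed.

Lemma act_word_cong (u v : word) : BS_cong c d u v -> act_word u =1 act_word v.
Proof.
elim=> {u v} [//|u v _ h p|v u w _ h _ h' p|u u' v v' _ h _ h' p|l p|p].
- by rewrite h.
- by rewrite h h'.
- by rewrite /act_word !foldr_cat -!/(act_word _ _) h' h.
- case: l p => [[] []] [k y] /=.
  + exact: fwd_aK.
  + exact: bwd_aK.
  + by rewrite /shift_b /= addrK.
  + by rewrite /shift_b /= subrK.
- rewrite -cats1 /act_word foldr_cat -!/(act_word _ _) act_nseq_b.
  rewrite -[LHS]/(fwd_a (act_word (nseq c letter_b) p)) act_nseq_b.
  by case: p => k y; rewrite /shift_b fwd_a_shift.
Qed.

Definition act g p : mpoint := act_word (repr g) p.

Lemma act_pi (w : word) p : act (\pi_(BS c d)%qT w) p = act_word w p.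
Proof. exact/act_word_cong/BS_reprP. Qed.

Lemma actM g h p : act (g * h)%g p = act g (act h p).
Proof.
have -> : (g * h)%g = \pi_(BS c d)%qT (repr g ++ repr h) by [].
by rewrite act_pi /act_word foldr_cat.
Qed.

Lemma act1 p : act 1%g p = p.
Proof. by rewrite -[1%g]/(\pi_(BS c d)%qT [::]) act_pi. Qed.

Lemma actK g : cancel (act g) (act (g^-1)%g).
Proof. by move=> p; rewrite -actM mulVg act1. Qed.

Lemma actVK g : cancel (act (g^-1)%g) (act g).
Proof. by move=> p; rewrite -actM mulgV act1. Qed.

Lemma act_a p : act (BSa c d) p = fwd_a p.
Proof. exact: act_pi. Qed.

Lemma act_b n p : act (BSb c d ^+ n)%g p = shift_b n%:Z p.
Proof. by rewrite BSb_exp act_pi act_nseq_b. Qed.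

Lemma act_aV p : act ((BSa c d)^-1)%g p = bwd_a p.
Proof. by rewrite -{1}(bwd_aK p) -act_a actK. Qed.

Lemma act_bV n p : act ((BSb c d ^+ n)^-1)%g p = shift_b (- n%:Z) p.
Proof.
rewrite -[in LHS](_ : act (BSb c d ^+ n)%g (shift_b (- n%:Z) p) = p) ?actK//.
by rewrite act_b /shift_b /= subrK; case: p.
Qed.

End Model.

(** * Normal forms of positive elements *)

Section PositiveElements.
Variables c d : nat.
Hypotheses (hc : (0 < c)%N) (hd : (0 < d)%N).
Local Notation G := (BS c d).
Local Notation a := (BSa c d).
Local Notation b := (BSb c d).
Local Open Scope group_scope.
Implicit Types (p : mpoint) (g h x y z : G).

Lemma BSpos_bX n : BSpos (b ^+ n).
Proof.
elim: n => [|n IH]; first by rewrite expg0; exact: BSpos1.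
by rewrite expgS; apply: BSposM => //; exact: BSposb.
Qed.

Lemma BSpos_ba j : BSpos (b ^+ j * a).
Proof. by apply: BSposM; [exact: BSpos_bX | exact: BSposa]. Qed.

Lemma bX_a_exchange t : b ^+ (d * t) * a = a * b ^+ (c * t).
Proof.
elim: t => [|t IH]; first by rewrite !muln0 !expg0 mul1g mulg1.
by rewrite !mulnS !expgnDr -mulgA IH mulgA -BS_rel mulgA.
Qed.

Lemma bX_a_div n : b ^+ n * a = b ^+ (n %% d) * a * b ^+ (c * (n %/ d)).
Proof.
by rewrite {1}(divn_eq n d) addnC expgnDr -!mulgA mulnC bX_a_exchange.
Qed.

(** Normal forms exist for all positive elements because b^d crosses a as b^c;
    the index n is the value of theta. *)
Inductive normal_form : nat -> G -> Prop :=
| NFb k : normal_form 0 (b ^+ k)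
| NFa n j g : (j < d)%N -> normal_form n g ->
    normal_form n.+1 (b ^+ j * a * g).

(** The statement is about all m at once because crossing a turns b^m into a
    different power of b. *)
Lemma normal_form_bM n g m : normal_form n g -> normal_form n (b ^+ m * g).
Proof.
move=> ng; elim: ng m => {n g} [k|n j g jd _ IH] m.
  by rewrite -expgnDr; exact: NFb.
rewrite !mulgA -expgnDr bX_a_div -mulgA.
by apply: NFa; [rewrite ltn_pmod | exact: IH].
Qed.

Lemma normal_form_aM n g : normal_form n g -> normal_form n.+1 (a * g).
Proof. by move=> ng; rewrite -[a]mul1g -(expg0 b); exact: NFa. Qed.

Lemma BSpos_normal_form g : BSpos g -> exists n, normal_form n g.
Proof.
suff H : BSpos g -> forall n h, normal_form n h -> exists m, normal_form m (g * h).
  by move=> /H /(_ _ _ (NFb 0)); rewrite expg0 mulg1.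
elim=> [|||x y _ IHx _ IHy] n h nh.
- by exists n; rewrite mul1g.
- by exists n.+1; exact: normal_form_aM.
- by exists n; rewrite -[b]expg1; exact: normal_form_bM.
- by have [m] := IHy _ _ nh; rewrite -mulgA => /IHx.
Qed.

Lemma normal_form_pos n g : normal_form n g -> BSpos g.
Proof.
elim=> {n g} [k|n j g _ _ IH]; first exact: BSpos_bX.
by apply: BSposM => //; apply: BSposM; [exact: BSpos_bX | exact: BSposa].
Qed.

Lemma BS_theta1 : BS_theta (1 : G) = 0%R.
Proof.
by apply: (addrI (BS_theta (1 : G))); rewrite -BS_thetaM mulg1 addr0.
Qed.

Lemma BS_theta_bX n : BS_theta (b ^+ n) = 0%R.
Proof.
elim: n => [|n IH]; first by rewrite expg0 BS_theta1.
by rewrite expgS BS_thetaM BS_theta_b IH addr0.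
Qed.

Lemma normal_form_theta n g : normal_form n g -> BS_theta g = n%:Z%R.
Proof.
elim=> {n g} [k|n j g _ _ IH]; first by rewrite BS_theta_bX.
by rewrite !BS_thetaM BS_theta_bX BS_theta_a IH add0r -[n.+1]add1n PoszD.
Qed.

Definition inX p : bool := if p.2 is inl _ then true else false.
(** Membership of p in g X, where X is the half of the model preserved by the
    monoid. For positive g this is the support of the range projection of the
    isometry attached to g. *)
Definition inS g p : bool := inX (act g^-1 p).

Lemma inS1 p : inS 1 p = inX p.
Proof. by rewrite /inS invg1 act1. Qed.

Lemma inSM g h p : inS (g * h) p = inS h (act g^-1 p).
Proof. by rewrite /inS invgM actM. Qed.

Lemma inX_act_b n p : inX (act (b ^+ n) p) = inX p.
Proof. by rewrite act_b. Qed.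

Lemma inX_act_bV n p : inX (act (b ^+ n)^-1 p) = inX p.
Proof. by rewrite act_bV. Qed.

Lemma inX_act_pos g p : BSpos g -> inX p -> inX (act g p).
Proof.
move=> gpos; elim: gpos p => [|||x y _ IHx _ IHy] p.
- by rewrite act1.
- by rewrite act_a//; case: p => k [].
- by rewrite -[b]expg1 inX_act_b.
- by move=> /IHy/IHx; rewrite actM.
Qed.

Lemma inS_mul_pos g h p : BSpos h -> inS (g * h) p -> inS g p.
Proof.
move=> hpos; rewrite inSM => /(inX_act_pos hpos).
by rewrite actVK.
Qed.

Lemma inS_le x z p : BSle x z -> inS z p -> inS x p.
Proof. by move=> xz zp; apply: (inS_mul_pos xz); rewrite mulVKg. Qed.

Lemma inS_b k p : inS (b ^+ k) p = inX p.
Proof. exact: inX_act_bV. Qed.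

Lemma inS_mul_b g k p : inS (g * b ^+ k) p = inS g p.
Proof. by rewrite inSM inS_b. Qed.

(** The sets b^j a X with j < d partition X by the residue of the first
    coordinate modulo d. *)
Lemma inS_ba j p : (j < d)%N -> inS (b ^+ j * a) p = inX p && (zrem d p.1 == j).
Proof.
move=> jd; rewrite inSM act_bV// /inS act_aV//.
case: p => k s; rewrite /shift_b /=.
have inXb q : inX (bwd_a c d q) = inX q && (zrem d q.1 == 0%N).
  by case: q => k' [y|y]//=; rewrite /inX /bwd_a/=; case: (zrem d k').
rewrite inXb /inX /=; congr (_ && _).
have k_lt := zrem_lt k hd.
apply/eqP/eqP => [h|<-]; last first.
  have -> : (k - (zrem d k)%:Z = zquo d k * d%:Z + 0%:Z)%R.
    by rewrite {1}(zdivE k hd) addrK addr0.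
  by rewrite zremD.
have -> : (k = zquo d (k - j%:Z) * d%:Z + j%:Z)%R.
  by have := zdivE (k - j%:Z)%R hd; rewrite h addr0 => <-; rewrite subrK.
by rewrite zremD.
Qed.

(** A negative power of b on the left of a can be moved to its right, since
    b^(dk) a = a b^(ck), and is finally absorbed by a large power of b on the
    right. *)
Lemma normal_form_b_absorb n y k : normal_form n y ->
  exists l, BSpos ((b ^+ k)^-1 * y * b ^+ l).
Proof.
move=> ny; elim: ny k => {n y} [m|n j y jd _ IH] k.
  exists k; rewrite -mulgA -expgnDr addnC expgnDr mulKg.
  exact: BSpos_bX.
have [l hl] := IH (c * k)%N; exists l.
have -> : (b ^+ k)^-1 * (b ^+ j * a * y) * b ^+ l =
    b ^+ (d * k - k) * (b ^+ j * a * ((b ^+ (c * k))^-1 * y * b ^+ l)).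
  apply: (mulgI (b ^+ k)); rewrite -!mulgA mulVKg [RHS]mulgA -expgnDr.
  rewrite subnKC ?leq_pmull// [RHS]mulgA -expgnDr addnC expgnDr -!mulgA.
  by rewrite [b ^+ (d * k) * _]mulgA bX_a_exchange -mulgA mulVKg.
by do !apply: BSposM => //; try exact: BSpos_bX; exact: BSposa.
Qed.

(** Either the normal forms first differ in some b^i a and b^j a, and then the
    sets lie over different residues, or one is a prefix of the other up to a
    power of b, and b preserves X. *)
Lemma normal_form_nested n m x y : (n <= m)%N -> normal_form n x -> normal_form m y ->
  (forall p, inS x p -> inS y p -> False) \/
  ((forall p, inS y p -> inS x p) /\ exists l, BSpos (x^-1 * (y * b ^+ l))).
Proof.
move=> nm nx; elim: nx m y nm => {n x} [k|n i x id nx IH] m y nm ny.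
  right; split=> [p|].
    by rewrite inS_b -inS1 -{1}[y]mul1g; apply: inS_mul_pos; exact: normal_form_pos ny.
  by have [l] := normal_form_b_absorb k ny; exists l; rewrite mulgA.
case: ny nm IH => {m y} // m j y jd ny; rewrite ltnS => nm IH.
have split_i p : inS (b ^+ i * a * x) p -> zrem d p.1 = i.
  by move=> /(inS_mul_pos (normal_form_pos nx)); rewrite inS_ba// => /andP[_ /eqP].
have split_j p : inS (b ^+ j * a * y) p -> zrem d p.1 = j.
  by move=> /(inS_mul_pos (normal_form_pos ny)); rewrite inS_ba// => /andP[_ /eqP].
have [eij|nij] := eqVneq i j; last first.
  by left=> p /split_i pi /split_j pj; rewrite -pi pj eqxx in nij.
rewrite -eij; have [disj|[sub [l hl]]] := IH _ _ nm ny.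
  by left=> p; rewrite inSM [inS (_ * y) p]inSM => /disj.
right; split=> [p|]; first by rewrite inSM [inS (_ * x) p]inSM => /sub.
exists l; set g := b ^+ i * a.
by rewrite invgM -[g * y * _]mulgA -[_ * g^-1 * _]mulgA mulKg.
Qed.

Lemma BSpos_nested x y : BSpos x -> BSpos y ->
  [\/ forall p, inS x p -> inS y p -> False,
      (forall p, inS y p -> inS x p) /\ exists l, BSpos (x^-1 * (y * b ^+ l))
    | (forall p, inS x p -> inS y p) /\ exists l, BSpos (y^-1 * (x * b ^+ l))].
Proof.
move=> /BSpos_normal_form[n nx] /BSpos_normal_form[m my].
have [nm|/ltnW mn] := leqP n m.
  by have [h|h] := normal_form_nested nm nx my; [apply: Or31 | apply: Or32].
have [disj|h] := normal_form_nested mn my nx; last exact: Or33.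
by apply: Or31 => p xp yp; exact: disj yp xp.
Qed.

Lemma inS_act g p : inS g (act g p) = inX p.
Proof. by rewrite /inS actK. Qed.

Lemma BSub_mul_b x y l : BSpos y -> BSpos (x^-1 * (y * b ^+ l)) -> BSub x y (y * b ^+ l).
Proof.
move=> ypos h; split=> //; first by apply: BSposM => //; exact: BSpos_bX.
by rewrite /BSle mulKg; exact: BSpos_bX.
Qed.

Lemma BSub_sym x y z : BSub x y z -> BSub y x z.
Proof. by case. Qed.

(** If yX is contained in xX then y b^l is an upper bound of x and y for some
    l; a least upper bound z lies below it, so zX contains y b^l X = yX. *)
Lemma BSlub_inS x y z : BSpos x -> BSpos y -> BSlub x y z ->
  forall p, inS z p = inS x p && inS y p.
Proof.
move=> xpos ypos [[zpos xz yz] zmin] p.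
apply/idP/andP => [zp|[xp yp]]; first by split; exact: inS_le zp.
case: (BSpos_nested xpos ypos) => [disj||].
- by have := disj _ xp yp.
- move=> [_ [l hl]]; have /zmin zle := BSub_mul_b ypos hl.
  by apply: (inS_le zle); rewrite inS_mul_b.
- move=> [_ [l hl]]; have /BSub_sym/zmin zle := BSub_mul_b xpos hl.
  by apply: (inS_le zle); rewrite inS_mul_b.
Qed.

Lemma no_BSub_inS x y : BSpos x -> BSpos y -> ~ (exists z, BSub x y z) ->
  forall p, inS x p && inS y p = false.
Proof.
move=> xpos ypos noub p; apply/negP => /andP[xp yp]; apply: noub.
case: (BSpos_nested xpos ypos) => [disj||].
- by have := disj _ xp yp.
- by move=> [_ [l hl]]; exists (y * b ^+ l); exact: BSub_mul_b.
- by move=> [_ [l hl]]; exists (x * b ^+ l); apply/BSub_sym/BSub_mul_b.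
Qed.

Lemma sum_nat_mul (N n : nat) (F : nat -> nat) :
  (\sum_(0 <= k < N * n) F k = \sum_(0 <= m < N) \sum_(0 <= i < n) F (m * n + i))%N.
Proof.
elim: N => [|N IH]; first by rewrite mul0n !big_geq.
rewrite big_nat_recr//= mulSnr -IH (big_cat_nat (n := N * n)) ?leq_addr//=.
congr addn; rewrite -{1}[(N * n)%N]add0n big_addn addKn.
by apply: eq_bigr => i _; rewrite addnC.
Qed.

Definition count_box (N M : nat) g : nat :=
  (\sum_(0 <= k < N) \sum_(0 <= y < M) inS g (k%:Z%R, inl y))%N.

Lemma count_box_b N M k : count_box N M (b ^+ k) = (N * M)%N.
Proof.
rewrite /count_box; under eq_bigr do under eq_bigr do rewrite inS_b /=.
by rewrite !sum_nat_const_nat !subn0 muln1.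
Qed.

(** The map b^j a carries the box with sides N c and M onto the points of
    residue j in the box with sides N d and M c. *)
Lemma count_box_ba N M j g : (j < d)%N -> BSpos g ->
  count_box (N * d) (M * c) (b ^+ j * a * g) = count_box (N * c) M g.
Proof.
move=> jd gpos; rewrite /count_box !sum_nat_mul; apply: eq_bigr => m _.
rewrite (bigD1_seq j) ?mem_index_iota ?iota_uniq//= [X in (_ + X)%N]big1_seq ?addn0.
  rewrite sum_nat_mul exchange_big /=; apply: eq_big_nat => r /andP[_ rc].
  apply: eq_bigr => y _; congr nat_of_bool.
  rewrite inSM /inS; congr (inX (act _ _)).
  rewrite invgM actM// act_bV// act_aV// /shift_b /= PoszD addrK PoszM.
  rewrite /bwd_a /= -[(m%:Z * d%:Z)%R]addr0 zremD// zquoD//=.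
  by rewrite modnMDl modn_small// divnMDl// divn_small// addn0 PoszD PoszM.
move=> i /andP[ij]; rewrite mem_index_iota => /andP[_ id].
rewrite big1// => y _; apply/eqP; rewrite eqb0; apply/negP.
move=> /(inS_mul_pos gpos); rewrite inS_ba// => /andP[_] /=.
by rewrite PoszD PoszM zremD// (negbTE ij).
Qed.

(** With these side lengths all divisions are exact at each letter, and the
    density of gX in the box is d^-n. *)
Lemma count_box_normal_form n g N M : normal_form n g ->
  count_box (N * d ^ n) (M * c ^ n) g = (N * (c ^ n * M))%N.
Proof.
move=> ng; elim: ng N M => {n g} [k|n j g jd ng IH] N M.
  by rewrite !expn0 count_box_b !muln1 mul1n.
rewrite !expnSr !mulnA count_box_ba//; last exact: normal_form_pos ng.
by rewrite mulnAC IH -!mulnA; congr (_ * _)%N; rewrite mulnCA.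
Qed.

End PositiveElements.
Arguments BSpos_ba {c d} j.

(** * States *)

Section Approximation.
Variables (R : realType) (A : cstarType R).
Local Open Scope classical_set_scope.
Implicit Types (x y z : A) (D : set A).

Definition approximable D x : Prop :=
  forall e : R, 0 < e -> exists2 y, D y & nrm (x - y) < e.

Lemma closed_approxP D : closed D <-> forall x, approximable D x -> D x.
Proof.
split=> [cD x apx|h x clx].
  apply: cD => B /nbhs_ballP[e /= e0 eB].
  have eE : e = (complex.Re e)%:C by rewrite RRe_real// gtr0_real.
  have e0' : 0 < complex.Re e by rewrite -ltcR -eE.
  have [y Dy xy] := apx _ e0'; exists y; split=> //; apply: eB.
  by rewrite -ball_normE/= nrmE eE ltcR.
apply: h => e e0; have [|y [Dy yB]] := clx (ball x e%:C).
  by apply: nbhsx_ballx; rewrite ltcR.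
by exists y => //; move: yB; rewrite -ball_normE/= nrmE ltcR.
Qed.

End Approximation.

Section LipschitzPreimage.
Variables (R : realType) (A B : cstarType R).
Local Open Scope classical_set_scope.

Lemma closed_preimage_lipschitz (f : A -> B) (K : R) (D : set B) :
  (forall x y, nrm (f x - f y) <= K * nrm (x - y)) ->
  closed D -> closed [set x | D (f x)].
Proof.
move=> fK cD0; have cD := proj1 (closed_approxP D) cD0.
apply: (proj2 (closed_approxP _)) => x apx.
apply: cD => e e0.
have K1 : 0 < `|K| + 1 by rewrite ltr_wpDl.
have [y Dy xy] := apx (e / (`|K| + 1)) (divr_gt0 e0 K1).
exists (f y) => //; apply: le_lt_trans (fK x y) _.
have h : K * nrm (x - y) <= (`|K| + 1) * nrm (x - y).
  by rewrite ler_wpM2r ?nrm_ge0// (le_trans (ler_norm K))// lerDl.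
by apply: le_lt_trans h _; rewrite mulrC -ltr_pdivlMr.
Qed.

End LipschitzPreimage.

Section States.
Variables (R : realType) (A : cstarType R).
Local Open Scope classical_set_scope.
Implicit Types (x y z : A) (phi psi : A -> R[i]).

Lemma functionalD phi : scalar phi -> {morph phi : x y / x + y}.
Proof. by move=> phil x y; rewrite -{1}(scale1r x) phil mul1r. Qed.

Lemma functional0 phi : scalar phi -> phi 0 = 0.
Proof. by move=> phil; apply: (addrI (phi 0)); rewrite -functionalD// !addr0. Qed.

Lemma functionalZ phi : scalar phi -> forall (k : R[i]) x, phi (k *: x) = k * phi x.
Proof. by move=> phil k x; rewrite -[k *: x]addr0 phil functional0// addr0. Qed.

Lemma functionalB phi : scalar phi -> {morph phi : x y / x - y}.
Proof.
by move=> phil x y; rewrite -scaleN1r functionalD// functionalZ// mulN1r.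
Qed.

(** Positivity at x + 1 and at i x + 1. *)
Lemma state_star phi : is_state phi -> forall x, phi (star x) = (phi x)^*.
Proof.
move=> [phil pos phi1] x.
have real y : complex.Im (phi (star y * y)) = 0 by apply: ger0_Im.
have h1 := real (x + 1); have h2 := real ('i%C *: x + 1).
move: h1 h2; rewrite !starD starZ star1 !mulrDl !mulrDr !mul1r !mulr1.
rewrite !functionalD// -star_scalerAl -star_scalerAr scalerA.
have -> : ('i%C : R[i])^* * 'i%C = 1.
  by apply/eqP; rewrite eq_complex /=; apply/andP; split; apply/eqP; ring.
rewrite scale1r !functionalZ// phi1 !ImD !real.
case: (phi x) => p q; case: (phi (star x)) => p' q' /= h1 h2.
by apply/eqP; rewrite eq_complex /=; apply/andP; split; apply/eqP; lra.
Qed.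

(** Positivity at x - phi(x) 1 gives |phi(x)|^2 <= phi(star x x). *)
Lemma state_bound phi : is_state phi -> forall x,
  complex.Re (phi x) ^+ 2 + complex.Im (phi x) ^+ 2 <= nrm x ^+ 2.
Proof.
move=> st x; have [phil pos phi1] := st.
have le1 : complex.Re (phi (star x * x)) <= nrm x ^+ 2.
  have := @pos_functional_bound R A (fun y => complex.Re (phi y)) _ _ _ x.
  rewrite phi1 /= mulr1; apply.
  - by move=> y z; rewrite functionalB//; case: (phi y) (phi z) => [? ?] [? ?].
  - by move=> r y; rewrite functionalZ//; case: (phi y) => [? ?] /=; rewrite mul0r subr0.
  - by move=> y; have := pos y; rewrite lecE => /andP[].
apply: le_trans le1.
have := pos (x - phi x *: (1 : A)).
rewrite starB starZ star1 mulrBl !mulrBr -!star_scalerAl -!star_scalerAr !mul1r !mulr1.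
rewrite !functionalB// !functionalZ// phi1 (state_star st).
case: (phi x) => p q; case: (phi (star x * x)) => r s.
by rewrite lecE /= => /andP[_]; lra.
Qed.

Lemma state_Re_bound phi x : is_state phi -> `|complex.Re (phi x)| <= nrm x.
Proof.
move=> st; rewrite -(ler_pXn2r (n := 2))// ?nnegrE ?nrm_ge0//.
have := state_bound st x; rewrite real_normK ?num_real//.
by have := sqr_ge0 (complex.Im (phi x)); lra.
Qed.

Lemma state_Im_bound phi x : is_state phi -> `|complex.Im (phi x)| <= nrm x.
Proof.
move=> st; rewrite -(ler_pXn2r (n := 2))// ?nnegrE ?nrm_ge0//.
have := state_bound st x; rewrite real_normK ?num_real//.
by have := sqr_ge0 (complex.Re (phi x)); lra.
Qed.

Lemma closed_state_eq phi psi : is_state phi -> is_state psi ->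
  closed [set x | phi x = psi x].
Proof.
move=> sphi spsi; apply: (proj2 (closed_approxP _)) => x apx; apply/eqP; rewrite -subr_eq0.
have [phil _ _] := sphi; have [psil _ _] := spsi.
have key (f : R[i] -> R) : {morph f : z w / z - w} ->
    (forall om y, is_state om -> `|f (om y)| <= nrm y) -> f (phi x - psi x) = 0.
  move=> fB fle; apply/eqP; rewrite -normr_le0; apply/ler_addgt0Pr => e e0.
  rewrite add0r; have e20 : 0 < e / 2 by rewrite divr_gt0.
  have [y /= yE xy] := apx _ e20.
  have -> : phi x - psi x = phi (x - y) - psi (x - y).
    by rewrite !functionalB// yE opprB addrA subrK.
  rewrite fB (le_trans (ler_normB _ _))// (splitr e).
  by apply: lerD; apply: le_trans (fle _ _ _) (ltW xy).
rewrite eq_complex /= (key (@complex.Re R)) ?(key (@complex.Im R)) ?eqxx//.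
- by move=> [? ?] [? ?].
- by move=> ? ? ?; exact: state_Im_bound.
- by move=> [? ?] [? ?].
- by move=> ? ? ?; exact: state_Re_bound.
Qed.

(** Weak-* compactness of the state space, as a limit along an ultrafilter that
    refines the cofinite filter. *)
Lemma state_sequence_limit (phi : nat -> A -> R[i]) :
  (forall n, is_state (phi n)) ->
  exists2 psi, is_state psi & forall x l,
    (\forall n \near \oo, phi n x = l) -> psi x = l.
Proof.
move=> st; have [U [UU sU]] := ultraFilterLemma eventually_filter.
have PU : ProperFilter U by exact: ultra_proper.
have ucvg (s : nat -> R) (K : R) : (forall n, `|s n| <= K) -> cvg (s @ U).
  move=> sK; have [|l [_ cl]] := @segment_compact R (- K) K (s @ U) _.
    by apply: (@filterE _ U _ _) => n /=; rewrite in_itv/= -ler_norml.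
  apply/cvg_ex; exists l => V Vl.
  have [//|UV] := in_ultra_setVsetC (s @^-1` V) UU.
  by have [r [nV rV]] := cl (~` V) V UV Vl; case: (nV rV).
pose re x n := complex.Re (phi n x); pose im x n := complex.Im (phi n x).
have cre x : cvg (re x @ U) by apply: (@ucvg _ (nrm x)) => n; exact: state_Re_bound.
have cim x : cvg (im x @ U) by apply: (@ucvg _ (nrm x)) => n; exact: state_Im_bound.
have near_lim (s : nat -> R) (l : R) : (\forall n \near \oo, s n = l) -> lim (s @ U) = l.
  move=> sl; apply: cvg_lim => //; apply: cvg_near_cst; exact: sU.
pose psi x := lim (re x @ U) +i* lim (im x @ U).
have psi_near x l : (\forall n \near \oo, phi n x = l) -> psi x = l.
  move=> h; apply/eqP; rewrite eq_complex /=; apply/andP; split; apply/eqP.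
    by apply: near_lim; apply: filterS h => n; rewrite /re => ->.
  by apply: near_lim; apply: filterS h => n; rewrite /im => ->.
have ulim_eq (s t : nat -> R) (l : R) : (forall n, s n = t n) ->
    t @ U --> l -> lim (s @ U) = l.
  by move=> /funext -> ?; exact: cvg_lim.
exists psi => //; split.
- move=> k x y; apply/eqP; rewrite eq_complex; apply/andP; split; apply/eqP.
    transitivity (complex.Re k * lim (re x @ U) - complex.Im k * lim (im x @ U)
                  + lim (re y @ U)); last by case: k.
    apply: ulim_eq (cvgD (cvgB (cvgM (cvg_cst (complex.Re k)) (cre x))
                         (cvgM (cvg_cst (complex.Im k)) (cim x))) (cre y)) => n.
    have [phil _ _] := st n; rewrite /re /im /= phil.
    by rewrite ReD ReM.
  transitivity (complex.Re k * lim (im x @ U) + complex.Im k * lim (re x @ U)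
                + lim (im y @ U)); last by case: k.
  apply: ulim_eq (cvgD (cvgD (cvgM (cvg_cst (complex.Re k)) (cim x))
                       (cvgM (cvg_cst (complex.Im k)) (cre x))) (cim y)) => n.
  have [phil _ _] := st n; rewrite /re /im /= phil.
  by rewrite ImD ImM.
- move=> x; have pos n : 0 <= phi n (star x * x) by have [_] := st n.
  rewrite lecE /=; apply/andP; split.
    by apply/eqP/near_lim/nearW => n; apply: ger0_Im.
  apply: limr_ge; first exact: cre.
  by apply: nearW => n; have := pos n; rewrite lecE => /andP[].
- by apply: psi_near; apply: nearW => n; have [] := st n.
Qed.

End States.

(** * A representation of the quotient *)

Section DiagonalStates.
Variables (R : realType) (E : choiceType).
Local Notation B := (bop R E : cstarType R).
Local Notation app := (@bopv R E).
Implicit Types (S T : B) (t : E).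

Lemma mul_bopE S T u : app (S * T) u = app S (app T u).
Proof. by []. Qed.

Lemma ip_i (w : l2 R E) : ip w ('i *: w) = 0 :> R.
Proof.
have h : ip w ('i *: w) = - ip w ('i *: w).
  rewrite {1}ipC ipJl -ipNr; congr ip; rewrite -scaleNr; congr (_ *: _).
  by apply/eqP; rewrite eq_complex /= oppr0 !eqxx.
by move: h; lra.
Qed.

Definition diag_coef t T : R[i] := app T (delta R t) t.

Lemma diag_coef_state t : is_state (diag_coef t : B -> R[i]).
Proof.
split.
- by move=> k S T.
- move=> T; rewrite lecE; apply/andP; split.
    rewrite Im_ip_delta mul_bopE -[star T]/(bop_adj T).
    by rewrite (is_adjoint_sym (bop_adjP T)) bopZ ip_i.
  rewrite -ip_delta mul_bopE -[star T]/(bop_adj T).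
  by rewrite (is_adjoint_sym (bop_adjP T)) ip_ge0.
- by rewrite /diag_coef /= /delta_fun eqxx.
Qed.

End DiagonalStates.

Section AverageStates.
Variables (R : realType) (A : cstarType R).

Lemma average_state (I : Type) (r : seq I) (phi : I -> A -> R[i]) :
  (0 < size r)%N -> (forall i, is_state (phi i)) ->
  is_state (fun x => ((size r)%:R)^-1 * \sum_(i <- r) phi i x).
Proof.
move=> r0 st.
have rN0 : (size r)%:R != 0 :> R[i] by rewrite pnatr_eq0 -lt0n.
split.
- move=> k x y; rewrite mulrCA -mulrDr; congr (_ * _).
  rewrite big_distrr -big_split /=; apply: eq_bigr => i _.
  by have [phil _ _] := st i; rewrite phil.
- move=> x; apply: mulr_ge0; first by rewrite invr_ge0 ler0n.
  by apply: sumr_ge0 => i _; have [_] := st i.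
- rewrite (eq_bigr (fun=> 1)); last by move=> i _; have [] := st i.
  by rewrite big_const_seq count_predT iter_addr_0 mulVf.
Qed.

End AverageStates.

Section Representation.
Variables (R : realType) (c d : nat).
Hypotheses (hc : (0 < c)%N) (hd : (0 < d)%N).
Local Notation G := (BS c d).
Local Notation E := ((int * nat) * G)%type.
Local Notation B := (bop R E : cstarType R).
Local Notation app := (@bopv R E).
Implicit Types (g h x y z : G) (t s : E).

(** The second coordinate is moved freely by G: this is what annihilates the
    diagonal coefficients of rep x star (rep y) for distinct x and y. *)
Definition translate g t : option E :=
  let p := act (g^-1)%g (t.1.1, inl t.1.2) in
  if p.2 is inl n then Some ((p.1, n), (g^-1 * t.2)%g) else None.

Lemma translateP g t s : translate g t = Some s <->
  act (g^-1)%g (t.1.1, inl t.1.2) = (s.1.1, inl s.1.2) /\ (g^-1 * t.2)%g = s.2.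
Proof.
rewrite /translate; case: (act _ _) => k [n|n] /=; split=> //.
- by move=> [<-].
- by case: s => [[k' n'] h] /= [[-> ->] ->].
- by move=> [].
Qed.

Lemma translate_inverse g : partial_inverse (translate (g^-1)%g) (translate g).
Proof.
move=> s t; rewrite !translateP invgK; split=> -[h1 h2].
  by rewrite -h1 -h2 actK// mulKg.
by rewrite -h1 -h2 actVK// mulVKg.
Qed.

Definition rep g : B := partial_isometry R (@translate_inverse g).

Lemma repE g u t : app (rep g) u t = if translate g t is Some s then u s else 0.
Proof. by []. Qed.

Lemma star_rep g : star (rep g) = rep (g^-1)%g.
Proof.
rewrite star_partial_isometry; apply: bop_ext => u; apply: l2_ext => t.
by rewrite !partial_isometryE.
Qed.

Lemma translate_inS g t : translate g t = if inS g (t.1.1, inl t.1.2)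
  then translate g t else None.
Proof. by rewrite /inS /inX /translate; case: (act _ _) => k []. Qed.

Lemma rep_projE x u t : app (rep x * star (rep x)) u t =
  if inS x (t.1.1, inl t.1.2) then u t else 0.
Proof.
rewrite mul_bopE star_rep repE translate_inS; case: ifPn => // xt.
have [s ts] : exists s, translate x t = Some s.
  by move: xt; rewrite /inS /inX /translate; case: (act _ _) => k [n|]//= _; eexists.
rewrite ts repE; have /translate_inverse -> := ts.
by [].
Qed.

Lemma rep_isometry x : BSpos x -> star (rep x) * rep x = 1.
Proof.
move=> xpos; rewrite star_rep; apply: bop_ext => u; apply: l2_ext => t.
rewrite mul_bopE repE.
have [s ts] : exists s, translate (x^-1)%g t = Some s.
  have := inX_act_pos hc hd xpos (_ : inX (t.1.1, inl t.1.2)).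
  move=> /(_ isT); rewrite /translate invgK /inX.
  by case: (act _ _) => k [n|]//= _; eexists.
by rewrite ts repE; have /translate_inverse -> := ts.
Qed.

Lemma rep1 : rep 1%g = 1.
Proof.
apply: bop_ext => u; apply: l2_ext => t; rewrite repE.
have -> : translate 1%g t = Some t; last by [].
by apply/translateP; rewrite invg1 act1// mul1g.
Qed.

Lemma repM x y : BSpos y -> rep (x * y)%g = rep x * rep y.
Proof.
move=> ypos; apply: bop_ext => u; apply: l2_ext => t.
rewrite mul_bopE !repE.
case xt : (translate x t) => [s|].
  rewrite repE; move/translateP: xt => [h1 h2].
  by rewrite /translate invgM actM// h1 -mulgA h2.
rewrite translate_inS; case: ifP => // /(inS_mul_pos hc hd ypos) xyt.
by move: xt; move: xyt; rewrite /inS /inX /translate; case: (act _ _) => k [].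
Qed.

(** Range projections are indicators of the sets xX, so they multiply as these
    sets intersect. *)
Lemma rep_nica : nica_covariant rep.
Proof.
split.
- exact: rep_isometry.
- exact: rep1.
- by move=> x y _; exact: repM.
- move=> x y z xpos ypos lub; apply: bop_ext => u; apply: l2_ext => t.
  rewrite [RHS]rep_projE mul_bopE [LHS]rep_projE (BSlub_inS hc hd xpos ypos lub).
  by case: ifP => //= _; rewrite [LHS]rep_projE.
- move=> x y xpos ypos noub; apply: bop_ext => u; apply: l2_ext => t.
  have := no_BSub_inS hc hd xpos ypos noub (t.1.1, inl t.1.2).
  move=> nxy; rewrite mul_bopE [LHS]rep_projE; case: ifP nxy => //= _ nyt.
  by rewrite [LHS]rep_projE nyt.
Qed.

Lemma bop_sumE (I : Type) (r : seq I) (T : I -> B) u t :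
  app (\sum_(i <- r) T i) u t = \sum_(i <- r) app (T i) u t.
Proof.
elim: r => [|i r IH]; first by rewrite !big_nil.
by rewrite !big_cons -IH.
Qed.

Lemma rep_cuntz : cuntz_defect rep = 0.
Proof.
apply/eqP; rewrite /cuntz_defect subr_eq0; apply/eqP/esym.
apply: bop_ext => u; apply: l2_ext => t; rewrite bop_sumE.
pose j0 := Ordinal (zrem_lt t.1.1 hd).
transitivity (\sum_(j < d)
    if inS (BSb c d ^+ j * BSa c d)%g (t.1.1, inl t.1.2) then u t else 0).
  by apply: eq_bigr => j _; exact: rep_projE.
rewrite (bigD1 j0)//= big1 => [|j jj0]; rewrite inS_ba//=.
  by rewrite eqxx addr0.
  exact: zrem_lt.
have -> : (zrem d t.1.1 == j) = false; last by [].
by apply: contraNF jj0 => /eqP jE; apply/eqP/val_inj.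
Qed.

Lemma diag_coef_rep x y k n : BSpos x ->
  diag_coef ((k, n), 1%g) (rep x * star (rep y)) =
  ((x == y) && inS x (k, inl n))%:R.
Proof.
move=> xpos; rewrite /diag_coef star_rep mul_bopE repE.
case xt : (translate x _) => [s|]; last first.
  rewrite (_ : inS _ _ = false) ?andbF//.
  by move: xt; rewrite /translate /inS /inX /=; case: (act _ _) => k' [].
have xS : inS x (k, inl n).
  by move: xt; rewrite /translate /inS /inX /=; case: (act _ _) => k' [].
rewrite xS andbT repE; have [<-|xy] := eqVneq x y.
  by have /translate_inverse -> := xt; rewrite /= /delta_fun eqxx.
case ys : (translate _ s) => [r|]//=; rewrite /delta_fun.
have -> // : (r == (k, n, 1%g)) = false.
apply: contraNF xy => /eqP rE; move/translateP: ys => [_]; rewrite rE invgK /=.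
move/translateP: xt => [_ <-] /=; rewrite mulg1 => /divg1_eq ->.
exact: eqxx.
Qed.

End Representation.

(** * The state on the quotient *)

Section StarHom.
Variables (R : realType) (A B : cstarType R) (f : A -> B).
Hypothesis fh : star_hom f.

Lemma star_hom_B : {morph f : x y / x - y}.
Proof.
by have [fl _ _ _] := fh; move=> x y; rewrite -scaleN1r addrC fl scaleN1r addrC.
Qed.

Lemma star_hom_0 : f 0 = 0.
Proof. by have := star_hom_B 0 0; rewrite !subrr. Qed.

Lemma star_hom_D : {morph f : x y / x + y}.
Proof.
by have [fl _ _ _] := fh; move=> x y; rewrite -[x in LHS]scale1r fl scale1r.
Qed.

Lemma star_hom_Z (k : R[i]) x : f (k *: x) = k *: f x.
Proof. by have [fl _ _ _] := fh; have := fl k x 0; rewrite star_hom_0 !addr0. Qed.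

Lemma star_hom_nica (c d : nat) (T : BS c d -> A) :
  nica_covariant T -> nica_covariant (f \o T).
Proof.
have [fl f1 fM fS] := fh; move=> [h1 h2 h3 h4 h5]; split=> /=.
- by move=> x xpos; rewrite -fS -fM h1.
- by rewrite h2.
- by move=> x y xpos ypos; rewrite h3.
- by move=> x y z xpos ypos lub; rewrite -!fS -!fM (h4 _ _ z).
- by move=> x y xpos ypos noub; rewrite -!fS -!fM h5 ?star_hom_0.
Qed.

Lemma star_hom_cuntz (c d : nat) (T : BS c d -> A) :
  f (cuntz_defect T) = cuntz_defect (f \o T).
Proof.
have [fl f1 fM fS] := fh; rewrite /cuntz_defect star_hom_B f1; congr (_ - _).
rewrite (big_morph f star_hom_D star_hom_0).
by apply: eq_bigr => j _; rewrite fM fS.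
Qed.

End StarHom.

Section ModelState.
Variables (R : realType) (c d : nat).
Hypotheses (hc : (0 < c)%N) (hd : (0 < d)%N).
Local Notation G := (BS c d).
Local Notation E := ((int * nat) * G)%type.
Local Notation B := (bop R E : cstarType R).
Implicit Types x y : G.

Definition box (N M : nat) : seq E :=
  [seq ((Posz k, n), 1%g) | k <- iota 0 N, n <- iota 0 M].

Lemma size_box N M : size (box N M) = (N * M)%N.
Proof. by rewrite size_allpairs !size_iota. Qed.

Definition box_average (k : nat) (T : B) : R[i] :=
  ((size (box (d ^ k) (c ^ k)))%:R)^-1 *
  \sum_(t <- box (d ^ k) (c ^ k)) diag_coef t T.

Lemma box_average_rep k n x y : (n <= k)%N -> normal_form n x ->
  box_average k (rep R hc hd x * star (rep R hc hd y)) =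
  (x == y)%:R * (d%:R ^+ n)^-1.
Proof.
move=> nk nx; have xpos := normal_form_pos nx; rewrite /box_average.
have -> : \sum_(t <- box (d ^ k) (c ^ k))
      diag_coef t (rep R hc hd x * star (rep R hc hd y)) =
    ((x == y) * count_box (d ^ k) (c ^ k) x)%N%:R :> R[i].
  rewrite /box big_allpairs_dep /count_box big_distrr natr_sum /index_iota subn0.
  apply: eq_bigr => k' _; rewrite big_distrr natr_sum /index_iota subn0.
  by apply: eq_bigr => n' _; rewrite diag_coef_rep// -mulnb.
rewrite size_box [((x == y) * _)%:R]natrM mulrCA; congr (_ * _).
have -> : count_box (d ^ k)%N (c ^ k)%N x = (d ^ (k - n) * (c ^ n * c ^ (k - n)))%N.
  by rewrite -(count_box_normal_form hc hd _ _ nx) -!expnD subnK.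
have -> : (d ^ k = d ^ (k - n) * d ^ n)%N by rewrite -expnD subnK.
rewrite -[(c ^ n * _)%N]expnD subnKC// !natrM !natrX.
have d0 : d%:R != 0 :> R[i] by rewrite pnatr_eq0 -lt0n.
have c0 : c%:R != 0 :> R[i] by rewrite pnatr_eq0 -lt0n.
by field; rewrite !expf_neq0.
Qed.

(** The averages are eventually constant on each monomial, so every limit point
    has these values. *)
Lemma model_state : exists2 omega : B -> R[i], is_state omega &
  forall n x y, normal_form n x ->
    omega (rep R hc hd x * star (rep R hc hd y)) = (x == y)%:R * (d%:R ^+ n)^-1.
Proof.
have st k : is_state (box_average k).
  apply: average_state; last exact: diag_coef_state.
  by rewrite size_box muln_gt0 !expn_gt0 hc hd.
have [omega st_omega lim] := state_sequence_limit st; exists omega => // n x y nx.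
by apply: lim; exists n => // k /= nk; exact: box_average_rep.
Qed.

End ModelState.

Section HomToOperators.
Variables (R : realType) (A : cstarType R) (E : choiceType).
Local Notation B := (bop R E : cstarType R).
Local Open Scope classical_set_scope.

(** For each vector u, the map x |-> <f(x) u, u> is a positive functional. *)
Lemma star_hom_bop_contractive (f : A -> B) : star_hom f ->
  forall x, nrm (f x) <= nrm x.
Proof.
move=> fh x; have [_ f1 fM fS] := fh; rewrite -[nrm (f x)]/(opnorm (f x)).
apply: opnorm_le => [|u]; first exact: nrm_ge0.
have := @pos_functional_bound R A (fun y => ip (bopv (f y) u) u) _ _ _ x.
have ipM y z : ip (bopv (f (star y * z)) u) u = ip (bopv (f z) u) (bopv (f y) u).
  rewrite fM fS mul_bopE -[star (f y)]/(bop_adj (f y)).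
  by rewrite (is_adjoint_sym (bop_adjP (f y))).
rewrite ipM f1 => h; rewrite l2norm_le ?mulr_ge0 ?nrm_ge0 ?l2norm_ge0// exprMn l2norm_sqr.
apply: h => [y z|r y|y].
- by rewrite (star_hom_B fh) [LHS]ipDl ipNl.
- by rewrite (star_hom_Z fh) [LHS]ipZl.
- by rewrite ipM ip_ge0.
Qed.

Lemma closed_set0 (C : cstarType R) : closed [set x : C | x = 0].
Proof.
apply: (proj2 (closed_approxP _)) => x apx; apply: nrm0_eq0; apply/eqP.
rewrite eq_le nrm_ge0 andbT; apply/ler_addgt0Pr => e e0; rewrite add0r.
by have [y /= -> /ltW] := apx _ e0; rewrite subr0.
Qed.

Lemma star_hom_bop_kernel (f : A -> B) : star_hom f ->
  closed_ideal [set x | f x = 0].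
Proof.
move=> fh; have [fl _ fM _] := fh.
split=> /=.
- exact: star_hom_0.
- by move=> k x y x0 y0; rewrite fl x0 y0 scaler0 addr0.
- by move=> x y y0; rewrite fM y0 mulr0.
- by move=> x y x0; rewrite fM x0 mul0r.
apply: (@closed_preimage_lipschitz _ _ _ f 1 [set x | x = 0]); last exact: closed_set0.
by move=> x y; rewrite -(star_hom_B fh) mul1r star_hom_bop_contractive.
Qed.

End HomToOperators.

Lemma state_comp (R : realType) (A B : cstarType R) (f : A -> B) (phi : B -> R[i]) :
  star_hom f -> is_state phi -> is_state (phi \o f).
Proof.
move=> [fl f1 fM fS] [phil pos phi1]; split=> /=.
- by move=> k x y; rewrite /= fl phil.
- by move=> x; rewrite fM fS.
- by rewrite f1.
Qed.

Section QuotientState.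
Variables (R : realType) (c d : nat).
Hypotheses (hc : (0 < c)%N) (hd : (0 < d)%N).
Variables (A : cstarType R) (T : BS c d -> A).
Hypothesis hT : universal_nica T.
Variables (O : cstarType R) (q : A -> O).
Hypothesis hq : is_quotient (generated_ideal (cuntz_defect T)) q.

(** The universal property gives a representation of A on l2; it kills the
    generator of the ideal and has a closed kernel, so the state that it
    induces on A factors through q. *)
Lemma quotient_state : exists2 psi : O -> R[i], is_state psi &
  forall n x y, normal_form n x -> BSpos y ->
    psi (q (T x) * star (q (T y))) = (x == y)%:R * (d%:R ^+ n)^-1.
Proof.
have [qh qonto qker] := hq; have [ql q1 qM qS] := qh.
have [nicaT _ univ] := hT.
have [f fh fT] := univ _ _ (rep_nica R hc hd).
have [fl f1 fM fS] := fh.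
have [omega st_omega omegaE] := model_state R hc hd.
have kerf z : q z = 0 -> f z = 0.
  move=> /qker /(_ _ (star_hom_bop_kernel fh)); apply => /=.
  rewrite (star_hom_cuntz fh) -(rep_cuntz R hc hd) /cuntz_defect; congr (_ - _).
  by apply: eq_bigr => j _ /=; rewrite !fT//; exact: BSpos_ba.
pose lift o := sval (cid (qonto o)).
have liftK o : q (lift o) = o by exact: (svalP (cid (qonto o))).
have fq z z' : q z = q z' -> f z = f z'.
  move=> e; apply/eqP; rewrite -subr_eq0 -(star_hom_B fh); apply/eqP.
  by apply: kerf; rewrite (star_hom_B qh) e subrr.
have [oml ompos om1] := st_omega.
exists (fun o => omega (f (lift o))).
  split.
  - by move=> k x y; rewrite -oml -fl; congr omega; apply: fq; rewrite ql !liftK.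
  - move=> x; suff -> : f (lift (star x * x)) = star (f (lift x)) * f (lift x) by [].
    by rewrite -fS -fM; apply: fq; rewrite qM qS !liftK.
  - by rewrite (fq _ 1) ?f1// liftK q1.
move=> n x y nx ypos; rewrite -qS -qM (fq _ (T x * star (T y))) ?liftK//.
by rewrite fM fS !fT ?(omegaE n)//; exact: normal_form_pos nx.
Qed.

End QuotientState.

(** * Wick ordering in the quotient *)

Section CuntzNica.
Variables (R : realType) (c d : nat).
Hypotheses (hc : (0 < c)%N) (hd : (0 < d)%N).
Variables (O : cstarType R) (V : BS c d -> O).
Hypotheses (nicaV : nica_covariant V) (cuntzV : cuntz_defect V = 0).
Local Notation G := (BS c d).
Local Notation a := (BSa c d).
Local Notation b := (BSb c d).
Implicit Types (g h x y z r s : G).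

Lemma nica1 : V 1%g = 1. Proof. by have [] := nicaV. Qed.

Lemma nicaM x y : BSpos x -> BSpos y -> V (x * y)%g = V x * V y.
Proof. by have [_ _ nicaM _ _] := nicaV; exact: nicaM. Qed.

Lemma nica_isometry x : BSpos x -> star (V x) * V x = 1.
Proof. by have [nica_isometry _ _ _ _] := nicaV; exact: nica_isometry. Qed.

Lemma sum_ba_projections : \sum_(j < d) V (b ^+ j * a)%g * star (V (b ^+ j * a)%g) = 1.
Proof. by have /eqP := cuntzV; rewrite subr_eq0 => /eqP. Qed.

Lemma nica_ba_orthogonal i j : (i < d)%N -> (j < d)%N -> i != j ->
  star (V (b ^+ i * a)%g) * V (b ^+ j * a)%g = 0.
Proof.
move=> id jd ij; have [_ _ _ _ V0] := nicaV.
have noub : ~ exists z, BSub (b ^+ i * a)%g (b ^+ j * a)%g z.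
  move=> [z [_ iz jz]]; have zz : inS z (act z (0, inl 0%N)) by rewrite inS_act.
  have := inS_le hc hd iz zz; have := inS_le hc hd jz zz.
  by rewrite !inS_ba// => /andP[_ /eqP ->] /andP[_ /eqP ji]; rewrite ji eqxx in ij.
have := V0 _ _ (BSpos_ba i) (BSpos_ba j) noub.
set x := V _; set y := V _ => h.
have -> : star x * y = star x * (x * star x * (y * star y)) * y.
  by rewrite !mulrA nica_isometry ?mul1r -?mulrA ?nica_isometry ?mulr1//; exact: BSpos_ba.
by rewrite h mulr0 mul0r.
Qed.

Lemma nica_baM j u : BSpos u -> V (b ^+ j * a * u)%g = V (b ^+ j * a)%g * V u.
Proof. by move=> upos; rewrite nicaM//; exact: BSpos_ba. Qed.

Lemma nica_bXD m n : V (b ^+ (m + n))%g = V (b ^+ m)%g * V (b ^+ n)%g.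
Proof. by rewrite expgnDr nicaM//; exact: BSpos_bX. Qed.

Lemma star_ba_mul_ba j n : (j < d)%N ->
  star (V (b ^+ j * a)%g) * V (b ^+ n * a)%g =
  if (n %% d == j)%N then V (b ^+ (c * (n %/ d)))%g else 0.
Proof.
move=> jd; rewrite (bX_a_div _ _ n) [V (_ * a * _)%g]nicaM ?mulrA;
  [|exact: BSpos_ba|exact: BSpos_bX].
have [->|nj] := eqVneq (n %% d)%N j; first by rewrite nica_isometry ?mul1r//; exact: BSpos_ba.
by rewrite nica_ba_orthogonal ?mul0r ?ltn_pmod// eq_sym.
Qed.

(** Insert the partition of unity given by the V (b^i a): b^(t + i) a begins
    with b^0 a only for the i with d | t + i, and the other terms vanish by
    orthogonality. *)
Lemma star_bX_mul_a t : exists j e, [/\ (j < d)%N, (t + j = d * e)%N &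
  star (V (b ^+ t)%g) * V a = V (b ^+ j * a)%g * star (V (b ^+ (c * e))%g)].
Proof.
(* j is the residue of -t modulo d. *)
pose j := ((d - t %% d) %% d)%N; pose e := ((t + j) %/ d)%N.
have jd : (j < d)%N by rewrite ltn_pmod.
have dtj : (d %| t + j)%N.
  rewrite /dvdn /j modnDmr -modnDml subnKC ?modnn//.
  by rewrite ltnW// ltn_pmod.
exists j, e; split=> //; first by rewrite /e mulnC divnK.
have term (i : 'I_d) : star (V (b ^+ i * a)%g) * (star (V (b ^+ t)%g) * V a) =
    if (i == Ordinal jd) then star (V (b ^+ (c * e))%g) else 0.
  rewrite mulrA -star_mul -nicaM; [|exact: BSpos_bX|exact: BSpos_ba].
  rewrite mulgA -expgnDr -[X in star _ * V X]mul1g -(expg0 b).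
  rewrite -[star _ * _]starK star_mul starK (star_ba_mul_ba _ hd).
  have -> : ((t + i) %% d == 0)%N = (i == Ordinal jd).
    rewrite -val_eqE /=; apply/eqP/eqP => [ti|->]; last by move/eqP: dtj.
    have : (t + i = t + j %[mod d])%N by rewrite ti; move/eqP: dtj.
    by move/eqP; rewrite eqn_modDl !modn_small// => /eqP.
  by case: eqP => [->//|_]; have := starB (0 : O) 0; rewrite !subrr.
rewrite -[LHS]mul1r -sum_ba_projections big_distrl /= (bigD1 (Ordinal jd))//=.
rewrite -mulrA (term (Ordinal jd)) eqxx big1 ?addr0// => i ij.
by rewrite -mulrA term (negbTE ij) mulr0.
Qed.

(** Wick ordering of star (V y) V p. The sets record that y r is a common upper
    bound of y and p of smallest range, so that a product which vanishes at one
    step of the induction comes from disjoint ranges of y and p themselves. *)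
Definition wick y p : Prop :=
  (star (V y) * V p = 0 /\ (forall t, inS y t -> inS p t -> False)) \/
  (exists r s, [/\ BSpos r, BSpos s, (y * r = p * s)%g,
     star (V y) * V p = V r * star (V s) &
     (BS_theta (y * r)%g = Num.max (BS_theta y) (BS_theta p)) /\
     (forall t, inS (y * r)%g t = inS y t && inS p t)]).

Lemma BSpos_theta_ge0 x : BSpos x -> 0 <= BS_theta x.
Proof. by move=> /(BSpos_normal_form hd)[n /(@normal_form_theta _ _) ->]. Qed.

Lemma inS_pos_inX x (t : mpoint) : BSpos x -> inS x t -> inX t.
Proof.
move=> xpos; rewrite -(inS1 hc hd) -{1}[x]mul1g; exact: inS_mul_pos.
Qed.

(** Moving star (V (b^k)) to the right through the letters of v, only powers of
    b appear on the starred side. *)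
Lemma star_bX_mul n v : normal_form n v -> forall k, exists r m,
  [/\ BSpos r, (b ^+ k * r = v * b ^+ m)%g &
      star (V (b ^+ k)%g) * V v = V r * star (V (b ^+ m)%g)].
Proof.
elim=> {n v} [l|n j u jd nu IH] k.
  have [kl|/ltnW lk] := leqP k l.
    exists (b ^+ (l - k))%g, 0%N; rewrite expg0 mulg1 -expgnDr subnKC//.
    split=> //; first exact: BSpos_bX.
    by rewrite nica1 star1 mulr1 -{1}(subnKC kl) nica_bXD mulrA nica_isometry ?mul1r//;
      exact: BSpos_bX.
  exists 1%g, (k - l)%N; rewrite mulg1 -expgnDr subnKC//; split=> //; first exact: BSpos1.
  by rewrite -{1}(subnKC lk) nica_bXD star_mul -mulrA nica_isometry ?nica1 ?mulr1 ?mul1r//;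
    exact: BSpos_bX.
have upos := normal_form_pos nu.
have [kj|/ltnW jk] := leqP k j.
  exists (b ^+ (j - k) * a * u)%g, 0%N; split.
  - by apply: BSposM => //; exact: BSpos_ba.
  - by rewrite expg0 mulg1 !mulgA -expgnDr subnKC.
  - rewrite expg0 nica1 star1 mulr1 -{1}(subnKC kj) expgnDr -!mulgA nicaM.
    + by rewrite mulrA nica_isometry ?mul1r//; exact: BSpos_bX.
    + exact: BSpos_bX.
    + by do !apply: BSposM => //; [exact: BSpos_bX | exact: BSposa].
have [j0 [e [j0d tj0 E]]] := star_bX_mul_a (k - j).
have [r [m [rpos rE rV]]] := IH (c * e)%N.
exists (b ^+ j0 * a * r)%g, m; split.
- by apply: BSposM => //; exact: BSpos_ba.
- rewrite -(mulgA _ u) -rE !mulgA -expgnDr -[in LHS](subnKC jk) -addnA tj0.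
  by rewrite expgnDr -!mulgA [(b ^+ (d * e) * _)%g]mulgA bX_a_exchange !mulgA.
- rewrite (nica_baM j0 rpos) -mulrA -rV mulrA -E -{1}(subnKC jk) nica_bXD star_mul.
  rewrite -(mulgA (b ^+ j)%g) nicaM; [|exact: BSpos_bX|by apply: BSposM => //; exact: BSposa].
  rewrite (nicaM (BSposa c d))// -[LHS]mulrA [star (V (b ^+ j)%g) * _]mulrA.
  by rewrite nica_isometry ?mul1r ?mulrA//; exact: BSpos_bX.
Qed.

Lemma wick_b v : BSpos v -> wick b v.
Proof.
move=> vpos; have [n nv] := BSpos_normal_form hd vpos.
have [r [m [rpos]]] := star_bX_mul nv 1; rewrite expg1 => rE rV.
right; exists r, (b ^+ m)%g; split=> //; first exact: BSpos_bX.
rewrite rE BS_thetaM BS_theta_bX// addr0 BS_theta_b; split=> [|x].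
  by rewrite max_r// BSpos_theta_ge0.
rewrite inS_mul_b// -[in inS b](expg1 b) inS_b//.
by case: (boolP (inS v x)) => [/(inS_pos_inX vpos) ->|]; rewrite ?andbF.
Qed.

Lemma wick_a v : BSpos v -> wick a v.
Proof.
move=> vpos; have [n nv] := BSpos_normal_form hd vpos.
case: nv vpos => {n v} [k|n j u jd nu] vpos.
  have [j0 [e [j0d kj0 E]]] := star_bX_mul_a k.
  right; exists (b ^+ (c * e))%g, (b ^+ j0 * a)%g.
  have arE : (a * b ^+ (c * e) = b ^+ k * (b ^+ j0 * a))%g.
    by rewrite mulgA -expgnDr kj0 bX_a_exchange.
  split=> //; [exact: BSpos_bX|exact: BSpos_ba| |].
    by rewrite -[LHS]starK star_mul starK E star_mul starK.
  rewrite BS_thetaM !BS_theta_bX// BS_theta_a addr0; split=> // x.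
  rewrite inS_mul_b// inS_b//.
  by case: (boolP (inS a x)) => [/(inS_pos_inX (BSposa c d)) ->|].
have upos := normal_form_pos nu.
have [j0|jN0] := eqVneq j 0%N.
  right; exists u, 1%g; subst j; rewrite expg0 mul1g; split=> //.
  - exact: BSpos1.
  - by rewrite mulg1.
  - by rewrite (nicaM (BSposa c d))// mulrA nica_isometry ?mul1r ?nica1 ?star1 ?mulr1//;
      exact: BSposa.
  split=> [|x]; first by rewrite max_r// BS_thetaM lerDl BSpos_theta_ge0.
  by case: (boolP (inS (a * u)%g x)) => [/(inS_mul_pos hc hd upos) ->|]; rewrite ?andbF.
left; rewrite -[a in V a]mul1g -(expg0 b); split.
  by rewrite nica_baM// mulrA nica_ba_orthogonal ?mul0r// eq_sym.
move=> x; rewrite -[a in inS a]mul1g -(expg0 b) inS_ba// => /andP[_ /eqP x0].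
move=> /(inS_mul_pos hc hd upos); rewrite inS_ba// x0 => /andP[_ /eqP j0].
by rewrite -j0 eqxx in jN0.
Qed.

(** As star (V (g y)) = star (V y) star (V g), the product with V p is ordered
    first for g and p, and the outcome V r star (V s) then for y and r. *)
Lemma wick_mul g y : BSpos g -> BSpos y ->
  (forall p, BSpos p -> wick g p) -> (forall p, BSpos p -> wick y p) ->
  forall p, BSpos p -> wick (g * y)%g p.
Proof.
move=> gpos ypos wg wy p ppos.
have VE : star (V (g * y)%g) * V p = star (V y) * (star (V g) * V p).
  by rewrite nicaM// star_mul mulrA.
have gyg t : inS (g * y)%g t -> inS g t by exact: inS_mul_pos.
have [[z0 disj]|[r [s [rpos spos rs rsV [th inr]]]]] := wg _ ppos.
  by left; rewrite VE z0 mulr0; split=> // x /gyg; exact: disj.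
have [[z0 disj]|[r' [s' [rpos' spos' rs' rsV' [th' inr']]]]] := wy _ rpos.
  left; rewrite VE rsV mulrA z0 mul0r; split=> // x gyx px.
  have := inr x; rewrite (gyg _ gyx) px [LHS]inSM//; apply: disj.
  by rewrite -inSM.
right; exists r', (s * s')%g; split=> //; first exact: BSposM.
- by rewrite -mulgA rs' !mulgA rs.
- by rewrite VE rsV mulrA rsV' -mulrA -star_mul nicaM.
split=> [|x].
  rewrite -mulgA [LHS]BS_thetaM th' addr_maxr -!BS_thetaM th maxA.
  congr Num.max; apply/max_idPl.
  by rewrite BS_thetaM lerDl BSpos_theta_ge0.
rewrite -mulgA [LHS]inSM// inr' -!inSM// inr andbA; congr (_ && _).
by case: (boolP (inS _ x)) => [/gyg ->|].
Qed.

Lemma wickP y p : BSpos y -> BSpos p -> wick y p.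
Proof.
move=> ypos; elim: ypos p => {y} [|||x y xpos IHx ypos IHy] p ppos.
- right; exists p, 1%g; rewrite mulg1 mul1g nica1 star1 mul1r mulr1; split=> //.
    exact: BSpos1.
  split=> [|x]; first by rewrite BS_theta1// max_r// BSpos_theta_ge0.
  by rewrite inS1//; case: (boolP (inS p x)) => [/(inS_pos_inX ppos) ->|]; rewrite ?andbF.
- exact: wick_a.
- exact: wick_b.
- exact: wick_mul.
Qed.

End CuntzNica.

(** * Monomials span a dense subspace *)

Section Density.
Variables (R : realType) (c d : nat).
Hypotheses (hc : (0 < c)%N) (hd : (0 < d)%N).
Variables (A : cstarType R) (T : BS c d -> A).
Hypothesis hT : universal_nica T.
Variables (O : cstarType R) (q : A -> O).
Hypothesis hq : is_quotient (generated_ideal (cuntz_defect T)) q.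
Local Open Scope classical_set_scope.

Let qh : star_hom q. Proof. by case: hq. Qed.

Lemma quotient_nica : nica_covariant (q \o T).
Proof. by apply: star_hom_nica => //; have [] := hT. Qed.

Lemma quotient_cuntz : cuntz_defect (q \o T) = 0.
Proof. by rewrite -star_hom_cuntz//; have [_ _ ->] := hq; move=> J _. Qed.

Definition closed_subspace (L : set A) : Prop :=
  (forall (k : R[i]) x y, L x -> L y -> L (k *: x + y)) /\ closed L.

Lemma closed_subspace_preimage (f : A -> A) (K : R) (s : R[i] -> R[i]) (L : set A) :
  (forall k x y, f (k *: x + y) = s k *: f x + f y) ->
  (forall x y, nrm (f x - f y) <= K * nrm (x - y)) ->
  closed_subspace L -> closed_subspace [set x | L (f x)].
Proof.
move=> fl fK [Ll Lc]; split; last exact: closed_preimage_lipschitz fK Lc.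
by move=> k x y /= Lx Ly; rewrite fl; exact: Ll.
Qed.

Lemma closed_subspace_mull (m : A) L : closed_subspace L ->
  closed_subspace [set x | L (m * x)].
Proof.
apply: (@closed_subspace_preimage _ (nrm m) id).
  by move=> k x y; rewrite mulrDr star_scalerAr.
by move=> x y; rewrite -mulrBr nrmM.
Qed.

Lemma closed_subspace_mulr (m : A) L : closed_subspace L ->
  closed_subspace [set x | L (x * m)].
Proof.
apply: (@closed_subspace_preimage _ (nrm m) id).
  by move=> k x y; rewrite mulrDl star_scalerAl.
by move=> x y; rewrite -mulrBl mulrC nrmM.
Qed.

Lemma closed_subspace_star L : closed_subspace L ->
  closed_subspace [set x | L (star x)].
Proof.
apply: (@closed_subspace_preimage _ 1 conjc).
  by move=> k x y; rewrite starD starZ.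
by move=> x y; rewrite -starB nrm_star mul1r.
Qed.

(** Taking the kernel of q into the span allows products of monomials to be
    computed with the relations of the quotient, while generation is used in A,
    where it is given. *)
Definition monomial_span : set A := [set z | forall L, closed_subspace L ->
  (forall x y, BSpos x -> BSpos y -> L (T x * star (T y))) ->
  (forall w, q w = 0 -> L w) -> L z].

Lemma monomial_span_mono x y : BSpos x -> BSpos y ->
  monomial_span (T x * star (T y)).
Proof. by move=> xpos ypos L _ mono _; exact: mono. Qed.

Lemma monomial_span_ker w : q w = 0 -> monomial_span w.
Proof. by move=> w0 L _ _; exact. Qed.

Lemma monomial_span_subspace : closed_subspace monomial_span.
Proof.
split=> [k x y Mx My L Ls mono ker|].
  by have [Ll _] := Ls; apply: Ll; [exact: Mx|exact: My].
apply: (proj2 (closed_approxP _)) => x apx L Ls mono ker.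
have [_ Lc] := Ls; apply: (proj1 (closed_approxP _) Lc) => e e0.
by have [y My xy] := apx e e0; exists y => //; exact: My.
Qed.

Lemma monomial_span_mono_mul x y p r : BSpos x -> BSpos y -> BSpos p -> BSpos r ->
  monomial_span ((T x * star (T y)) * (T p * star (T r))).
Proof.
move=> xpos ypos ppos rpos; have [_ q1 qM qS] := qh.
have [[_ _ TM _ _] _ _] := hT.
have zero : monomial_span 0 by apply: monomial_span_ker; rewrite star_hom_0.
have qE : q ((T x * star (T y)) * (T p * star (T r))) =
    q (T x) * (star (q (T y)) * q (T p)) * star (q (T r)).
  by rewrite !qM !qS !mulrA.
have [[z _]|[u [v [upos vpos _ uv _]]]] := wickP hc hd quotient_nica quotient_cuntz ypos ppos.
  by apply: monomial_span_ker; rewrite qE [_ * q (T p)]z mulr0 mul0r.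
have [lin _] := monomial_span_subspace.
rewrite -[_ * _](subrK (T (x * u)%g * star (T (r * v)%g))).
rewrite -[X in monomial_span (X + _)]scale1r; apply: lin; last first.
  by apply: monomial_span_mono; exact: BSposM.
apply: monomial_span_ker; rewrite star_hom_B// qE [star _ * q (T p)]uv.
by rewrite !TM// !qM qS qM star_mul /= !mulrA subrr.
Qed.

Lemma monomial_span_mul_ker_l w z : q w = 0 -> q (w * z) = 0.
Proof. by have [_ _ qM _] := qh; rewrite qM => ->; rewrite mul0r. Qed.

Lemma monomial_span_mul_ker_r w z : q w = 0 -> q (z * w) = 0.
Proof. by have [_ _ qM _] := qh; rewrite qM => ->; rewrite mulr0. Qed.

(** Left and right multiplications are continuous, so closure under products
    need only be checked with one factor a monomial, and then with both. *)
Lemma monomial_span_star_subalgebra : closed_star_subalgebra monomial_span.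
Proof.
have [[TK T1 TM _ _] _ _] := hT; have [_ _ qM qS] := qh.
have [lin cl] := monomial_span_subspace.
have mulm x y z : BSpos x -> BSpos y -> monomial_span z ->
    monomial_span (T x * star (T y) * z).
  move=> xpos ypos Mz.
  apply: (Mz _ (closed_subspace_mull (T x * star (T y)) monomial_span_subspace)).
    by move=> p r ppos rpos /=; exact: monomial_span_mono_mul.
  by move=> w w0 /=; apply: monomial_span_ker; exact: monomial_span_mul_ker_r w0.
split=> //.
- have := monomial_span_mono (@BSpos1 c d) (@BSpos1 c d).
  by rewrite T1 star1 mulr1.
- move=> x y Mx My.
  apply: (Mx _ (closed_subspace_mulr y monomial_span_subspace)).
    by move=> p r ppos rpos /=; exact: mulm.
  by move=> w w0 /=; apply: monomial_span_ker; exact: monomial_span_mul_ker_l w0.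
- move=> x Mx; apply: (Mx _ (closed_subspace_star monomial_span_subspace)).
    by move=> p r ppos rpos /=; rewrite star_mul starK; exact: monomial_span_mono.
  move=> w w0 /=; apply: monomial_span_ker.
  by rewrite qS w0; have := starB (0 : O) 0; rewrite !subrr.
Qed.

Lemma monomial_spanT z : monomial_span z.
Proof.
have [[_ T1 _ _ _] gen _] := hT; apply: gen; first exact: monomial_span_star_subalgebra.
move=> x xpos; have := monomial_span_mono xpos (@BSpos1 c d).
by rewrite T1 star1 mulr1.
Qed.

Lemma quotient_state_ext (phi psi : O -> R[i]) : is_state phi -> is_state psi ->
  (forall x y, BSpos x -> BSpos y ->
     phi (q (T x) * star (q (T y))) = psi (q (T x) * star (q (T y)))) ->
  phi = psi.
Proof.
move=> sphi spsi e; have [_ _ qM qS] := qh; have [_ qonto _] := hq.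
have sphi' := state_comp qh sphi; have spsi' := state_comp qh spsi.
have [phil _ _] := sphi'; have [psil _ _] := spsi'.
apply/funext => o; have [z <-] := qonto o.
apply: (monomial_spanT z (L := [set z | (phi \o q) z = (psi \o q) z])).
- split; last exact: closed_state_eq.
  by move=> k x y /= xe ye; have := phil k x y; have := psil k x y => /= -> ->; rewrite xe ye.
- by move=> x y xpos ypos /=; rewrite qM qS; exact: e.
- move=> w w0 /=; rewrite w0.
  by have [h _ _] := sphi; have [h' _ _] := spsi; rewrite !functional0.
Qed.

End Density.

(** * KMS states *)

Section Weights.
Variables (R : realType) (d : nat).
Hypothesis hd : (0 < d)%N.

Definition kms_weight (beta : R) (t : int) : R[i] := (expR (- beta * t%:~R))%:C.

Lemma kms_weightD beta s t : kms_weight beta (s + t) = kms_weight beta s * kms_weight beta t.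
Proof. by rewrite /kms_weight rmorphD mulrDr expRD rmorphM. Qed.

Lemma kms_weight_ln_nat n : kms_weight (ln d%:R) n%:Z = (d%:R ^+ n)^-1.
Proof.
rewrite /kms_weight mulNr expRN -[n%:~R]/(n%:R) expRM_natr lnK ?posrE ?ltr0n//.
by rewrite fmorphV rmorphXn rmorph_nat.
Qed.

End Weights.

Section KMS.
Variables (R : realType) (c d : nat).
Hypotheses (hc : (0 < c)%N) (hd : (0 < d)%N).
Variables (O : cstarType R) (V : BS c d -> O).
Hypotheses (nicaV : nica_covariant V) (cuntzV : cuntz_defect V = 0).
Local Notation G := (BS c d).
Local Notation a := (BSa c d).
Local Notation b := (BSb c d).
Implicit Types (g h x y z r s p q : G).

Section Existence.
Variable psi : O -> R[i].
Hypothesis st_psi : is_state psi.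
Hypothesis psiE : forall x y, BSpos x -> BSpos y ->
  psi (V x * star (V y)) = (x == y)%:R * kms_weight (ln d%:R) (BS_theta x).

Lemma psi_monomial_mul x y p q : BSpos x -> BSpos y -> BSpos p -> BSpos q ->
  psi ((V x * star (V y)) * (V p * star (V q))) != 0 ->
  exists r s, [/\ BSpos r, BSpos s, (y * r = p * s)%g, (x * r = q * s)%g &
    psi ((V x * star (V y)) * (V p * star (V q))) =
      kms_weight (ln d%:R) (BS_theta x - BS_theta y + Num.max (BS_theta y) (BS_theta p))].
Proof.
move=> xpos ypos ppos qpos.
have -> : V x * star (V y) * (V p * star (V q)) =
    V x * (star (V y) * V p) * star (V q) by rewrite !mulrA.
have [psil _ _] := st_psi.
have [[-> _]|] := wickP hc hd nicaV cuntzV ypos ppos.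
  by rewrite mulr0 mul0r functional0// eqxx.
move=> [r [s [rpos spos yr -> [th _]]]].
have -> : V x * (V r * star (V s)) * star (V q) = V (x * r)%g * star (V (q * s)%g).
  by rewrite !(nicaM nicaV)// star_mul !mulrA.
rewrite psiE; [|exact: BSposM|exact: BSposM].
have [xr|] := eqVneq (x * r)%g (q * s)%g; last by rewrite mul0r eqxx.
move=> _; exists r, s; split=> //; rewrite mul1r; congr kms_weight.
by rewrite -th !BS_thetaM addrA subrK.
Qed.

(** If the left side is non-zero then x r = q s and y r = p s, so the element
    x y^-1 = q p^-1 carries the pair (y, p) to (x, q). The translate of a common
    upper bound is a common upper bound, so the product on the right is
    non-zero too and the exponents of d differ by theta x - theta y. *)
Lemma psi_KMS_neq0 x y p q : BSpos x -> BSpos y -> BSpos p -> BSpos q ->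
  psi ((V x * star (V y)) * (V p * star (V q))) != 0 ->
  psi ((V x * star (V y)) * (V p * star (V q))) =
    kms_weight (ln d%:R) (BS_theta x - BS_theta y) *
    psi ((V p * star (V q)) * (V x * star (V y))).
Proof.
move=> xpos ypos ppos qpos nz.
have [r [s [rpos spos yr xr ->]]] := psi_monomial_mul xpos ypos ppos qpos nz.
have -> : V p * star (V q) * (V x * star (V y)) =
    V p * (star (V q) * V x) * star (V y) by rewrite !mulrA.
have [[_ disj]|] := wickP hc hd nicaV cuntzV qpos xpos.
  exfalso; have xrx : inS (x * r)%g (act (x * r)%g (0, inl 0%N)) by rewrite inS_act.
  by apply: (disj _ _ (inS_mul_pos hc hd rpos xrx)); move: xrx;
    rewrite {1}xr => /(inS_mul_pos hc hd spos).
move=> [r' [s' [rpos' spos' qr' -> [th _]]]].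
have -> : V p * (V r' * star (V s')) * star (V y) = V (p * r')%g * star (V (y * s')%g).
  by rewrite !(nicaM nicaV)// star_mul !mulrA.
rewrite psiE; [|exact: BSposM|exact: BSposM].
have -> : (p * r' = y * s')%g.
  have e : (p * q^-1 = y * x^-1)%g.
    have -> : p = (y * r * s^-1)%g by rewrite yr mulgK.
    have -> : x = (q * s * r^-1)%g by rewrite -xr mulgK.
    by rewrite !invgM invgK !mulgA.
  by rewrite -[r'](mulKg q) qr' mulgA e -!mulgA mulKg.
rewrite eqxx mul1r -kms_weightD; congr kms_weight.
have ths : BS_theta x + BS_theta r = BS_theta q + BS_theta s by rewrite -!BS_thetaM xr.
have thr : BS_theta y + BS_theta r = BS_theta p + BS_theta s by rewrite -!BS_thetaM yr.
move: th; rewrite !BS_thetaM => th.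
have := congr1 (@BS_theta c d) qr'; rewrite !BS_thetaM.
by move: th ths thr; lia.
Qed.

(** By psi_KMS_neq0 applied to both orders of the factors, the two sides
    vanish simultaneously. *)
Lemma psi_KMS x y p q : BSpos x -> BSpos y -> BSpos p -> BSpos q ->
  psi ((V x * star (V y)) * (V p * star (V q))) =
    kms_weight (ln d%:R) (BS_theta x - BS_theta y) *
    psi ((V p * star (V q)) * (V x * star (V y))).
Proof.
move=> xpos ypos ppos qpos.
have [z1|] := eqVneq (psi ((V x * star (V y)) * (V p * star (V q)))) 0;
  last exact: psi_KMS_neq0.
have [z2|nz2] := eqVneq (psi ((V p * star (V q)) * (V x * star (V y)))) 0.
  by rewrite z1 z2 mulr0.
by move: (nz2); rewrite psi_KMS_neq0// z1 mulr0 eqxx.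
Qed.

End Existence.

Section Uniqueness.
Variables (alpha : R -> O -> O) (beta : R) (phi : O -> R[i]).
Hypothesis kms : is_KMS V alpha beta phi.
Hypothesis ndc : ~~ (d %| c)%N.

Let st_phi : is_state phi. Proof. by have [] := kms. Qed.
Let phil : scalar phi. Proof. by have [] := st_phi. Qed.

Lemma d_gt1 : (1 < d)%N.
Proof. by move: hd ndc; case: d => [|[|n]]//; rewrite dvd1n. Qed.

Lemma phi_swap x y : BSpos x -> BSpos y ->
  phi (V x * star (V y)) = kms_weight beta (BS_theta x) * phi (star (V y) * V x).
Proof.
move=> xpos ypos; have [_ K _] := kms.
have := K x 1%g 1%g y xpos (@BSpos1 c d) (@BSpos1 c d) ypos.
by rewrite (nica1 nicaV) star1 !mulr1 !mul1r BS_theta1 subr0.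
Qed.

Lemma phi_diff x y : BSpos x -> BSpos y ->
  phi (V x * star (V y)) =
  kms_weight beta (BS_theta x - BS_theta y) * phi (V x * star (V y)).
Proof.
move=> xpos ypos; have [_ K _] := kms.
have := K x y 1%g 1%g xpos ypos (@BSpos1 c d) (@BSpos1 c d).
by rewrite (nica1 nicaV) star1 !mulr1 !mul1r.
Qed.

Lemma BS_theta_ba j : BS_theta (b ^+ j * a)%g = 1.
Proof. by rewrite BS_thetaM BS_theta_bX BS_theta_a add0r. Qed.

(** The range projections of the V (b^j a) have equal mass and sum to 1. *)
Lemma phi_d_kms_weight : d%:R * kms_weight beta 1 = 1.
Proof.
have [_ _ phi1] := st_phi; rewrite -[RHS]phi1 -(sum_ba_projections cuntzV).
rewrite (big_morph phi (functionalD phil) (functional0 phil)).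
rewrite (eq_bigr (fun=> kms_weight beta 1)); first by rewrite sumr_const card_ord mulr_natl.
move=> j _; rewrite phi_swap ?(nica_isometry nicaV)// ?phi1 ?mulr1 ?BS_theta_ba//;
  exact: BSpos_ba.
Qed.

Lemma KMS_beta : beta = ln d%:R.
Proof.
have := phi_d_kms_weight; rewrite /kms_weight mulr1 -(rmorph_nat (real_complex R)) -rmorphM.
move=> /complexI; rewrite expRN => h.
have e0 : expR beta != 0 by rewrite gt_eqF// expR_gt0.
by rewrite -[beta]expRK; congr ln; rewrite -[RHS](mulfVK e0) h mul1r.
Qed.

(** Insert the partition of unity: V (b^m) sends the range of V (b^j a) into
    that of V (b^i a) with i = m + j modulo d, which is orthogonal to it unless
    d divides m. *)
Lemma phi_bX_step m : phi (V (b ^+ m)%g) =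
  if (d %| m)%N then phi (V (b ^+ (c * (m %/ d)))%g) else 0.
Proof.
rewrite -[V _]mulr1 -(sum_ba_projections cuntzV) big_distrr /=.
rewrite (big_morph phi (functionalD phil) (functional0 phil)).
have term (j : 'I_d) : phi (V (b ^+ m)%g * (V (b ^+ j * a)%g * star (V (b ^+ j * a)%g))) =
    kms_weight beta 1 * if (d %| m)%N then phi (V (b ^+ (c * (m %/ d)))%g) else 0.
  rewrite mulrA -(nicaM nicaV); [|exact: BSpos_bX|exact: BSpos_ba].
  rewrite mulgA -expgnDr phi_swap ?BS_theta_ba; [|exact: BSpos_ba|exact: BSpos_ba].
  rewrite (star_ba_mul_ba hc hd nicaV)//; congr (_ * _).
  have -> : ((m + j) %% d == j)%N = (d %| m)%N.
    rewrite -{2}(modn_small (ltn_ord j)) -{2}(add0n (j : nat)) eqn_modDr.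
    by rewrite mod0n.
  case: ifP => dm; last by rewrite functional0.
  by rewrite divnDl// (divn_small (ltn_ord j)) addn0.
rewrite (eq_bigr _ (fun j _ => term j)) sumr_const card_ord -mulr_natl mulrA.
by rewrite phi_d_kms_weight mul1r.
Qed.

(** Write c / d = c' / d' in lowest terms. Then d' > 1, and m |-> cm/d lowers
    the exponent of the largest power of d' dividing m. *)
Lemma phi_bX m : (0 < m)%N -> phi (V (b ^+ m)%g) = 0.
Proof.
pose g := gcdn c d; pose c' := (c %/ g)%N; pose d' := (d %/ g)%N.
have g0 : (0 < g)%N by rewrite gcdn_gt0 hc.
have cE : c = (c' * g)%N by rewrite divnK ?dvdn_gcdl.
have dE : d = (d' * g)%N by rewrite divnK ?dvdn_gcdr.
have cop : coprime d' c'.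
  by rewrite coprime_sym /coprime -(eqn_pmul2r g0) muln_gcdl -cE -dE mul1n.
have d'1 : (1 < d')%N.
  rewrite ltn_neqAle eq_sym; apply/andP; split.
    by apply: contra ndc => /eqP d1; rewrite cE dE d1 mul1n dvdn_mull.
  by rewrite divn_gt0// dvdn_leq// dvdn_gcdr.
have main k : forall m, (0 < m)%N -> ~~ (d' ^ k %| m)%N -> phi (V (b ^+ m)%g) = 0.
  elim: k => [|k IH] {}m m0; first by rewrite expn0 dvd1n.
  move=> nk; rewrite phi_bX_step; case: ifP => // /dvdnP[e mE].
  rewrite mE mulnK//; have e0 : (0 < e)%N by move: m0; rewrite mE muln_gt0 => /andP[].
  apply: (IH (c * e)%N); first by rewrite muln_gt0 hc.
  apply: contra nk; rewrite [X in (_ %| X * e)%N]cE -mulnA mulnC Gauss_dvdl ?coprimeXl// => h.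
  by rewrite mE [X in (_ %| _ * X)%N]dE mulnC -mulnA expnS dvdn_mul.
move=> m0; apply: (main m _ m0); apply/negP => /(dvdn_leq m0).
by rewrite leqNgt ltn_expl.
Qed.

Lemma normal_form0_theta0 r : BSpos r -> BS_theta r = 0 -> exists k, r = (b ^+ k)%g.
Proof.
move=> /(BSpos_normal_form hd)[n nr]; rewrite (normal_form_theta nr) => -[n0].
by case: nr n0 => // k _; exists k.
Qed.

Lemma phi_star (x : O) : phi (star x) = (phi x)^*.
Proof. exact: state_star. Qed.

Lemma phi_bX_mul k l : k != l -> phi (V (b ^+ k)%g * star (V (b ^+ l)%g)) = 0.
Proof.
move=> kl; rewrite phi_swap; [|exact: BSpos_bX|exact: BSpos_bX].
have [lk|kl'|/eqP] := ltngtP l k; last by rewrite eq_sym (negbTE kl).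
  rewrite -(subnKC (ltnW lk)) (nica_bXD nicaV) mulrA (nica_isometry nicaV);
    last exact: BSpos_bX.
  by rewrite mul1r phi_bX ?subn_gt0// mulr0.
rewrite -(subnKC (ltnW kl')) (nica_bXD nicaV) star_mul -mulrA (nica_isometry nicaV);
  last exact: BSpos_bX.
by rewrite mulr1 phi_star phi_bX ?subn_gt0// conjc0 mulr0.
Qed.

(** The KMS condition turns phi (V x star (V y)) into a multiple of
    phi (star (V y) V x). For theta x = theta y the ordered form of the product
    only involves powers of b; otherwise the KMS condition against 1 multiplies
    the value by a factor different from 1. *)
Lemma phi_monomial x y : BSpos x -> BSpos y ->
  phi (V x * star (V y)) = (x == y)%:R * kms_weight (ln d%:R) (BS_theta x).
Proof.
move=> xpos ypos; rewrite -KMS_beta.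
have [<-|xy] := eqVneq x y.
  by rewrite phi_swap// (nica_isometry nicaV)//; have [_ _ ->] := st_phi; rewrite mulr1 mul1r.
rewrite mul0r; have [thxy|thxy] := eqVneq (BS_theta x) (BS_theta y); last first.
  have := phi_diff xpos ypos; set z := phi _ => zE.
  apply/eqP; apply: contraT => z0.
  have : kms_weight beta (BS_theta x - BS_theta y) = 1.
    by apply: (mulIf z0); rewrite -zE mul1r.
  rewrite /kms_weight => /complexI; rewrite -[RHS]expR0 => /expR_inj /eqP.
  rewrite mulf_eq0 oppr_eq0.
  rewrite intr_eq0 subr_eq0 (negbTE thxy) orbF KMS_beta.
  by rewrite gt_eqF// ln_gt0// ltr1n d_gt1.
rewrite phi_swap//.
have [[-> _]|] := wickP hc hd nicaV cuntzV ypos xpos; first by rewrite functional0// mulr0.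
move=> [r [s [rpos spos yr -> [th _]]]].
have th_r : BS_theta r = 0 by move: th; rewrite BS_thetaM thxy; lia.
have th_s : BS_theta s = 0.
  by have := congr1 (@BS_theta c d) yr; rewrite !BS_thetaM thxy; lia.
have [k rE] := normal_form0_theta0 rpos th_r.
have [l sE] := normal_form0_theta0 spos th_s.
rewrite rE sE phi_bX_mul ?mulr0//; apply: contraNneq xy => kl.
by apply/eqP; apply: (@mulIg _ s); rewrite -yr rE sE kl.
Qed.

End Uniqueness.
End KMS.

Theorem proposition7p1 (R : realType) (c d : nat) (hc : (0 < c)%N) (hd : (0 < d)%N)
    (A : cstarType R) (T : BS c d -> A) (hT : universal_nica T)
    (alpha : R -> A -> A) (halpha : is_gauge_dynamics T alpha)
    (O : cstarType R) (q : A -> O)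
    (hq : is_quotient (generated_ideal (cuntz_defect T)) q)
    (alphaO : R -> O -> O) (halphaO : is_dynamics alphaO)
    (halphaq : forall t z, alphaO t (q z) = q (alpha t z)) :
  let Tb (x : BS c d) : O := q (T x) in
  exists psi : O -> R[i],
    [/\ is_KMS Tb alphaO (ln d%:R) psi,
        forall x y, BSpos x -> BSpos y ->
          psi (Tb x * star (Tb y)) =
            (x == y)%:R * (expR (- ln d%:R * (BS_theta x)%:~R))%:C,
        forall x y, BSpos x -> BSpos y ->
          psi (Tb x * star (Tb y)) = (x == y)%:R * d%:R ^ (- BS_theta x)
      & ~~ (d %| c)%N ->
          forall (beta : R) (phi : O -> R[i]),
            is_KMS Tb alphaO beta phi -> beta = ln d%:R /\ phi = psi].
Proof.
move=> Tb; have nicaTb := quotient_nica hT hq; have cuntzTb := quotient_cuntz hq.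
have [psi st_psi psiE] := quotient_state hc hd hT hq.
have psi_weight x y : BSpos x -> BSpos y ->
    psi (Tb x * star (Tb y)) = (x == y)%:R * kms_weight (ln d%:R) (BS_theta x).
  move=> xpos ypos; have [n nx] := BSpos_normal_form hd xpos.
  by rewrite (psiE n)// (normal_form_theta nx) kms_weight_ln_nat.
exists psi; split=> //.
- split=> //.
    by move=> x y p r xpos ypos ppos rpos; exact: psi_KMS.
  move=> _ t z; have [dynO _ _ _] := halphaO.
  rewrite -[LHS]/((psi \o alphaO t) z); congr (_ z).
  apply: (quotient_state_ext hc hd hT hq) => //; first exact: state_comp.
  move=> x y xpos ypos /=; have [_ _ OM OS] := dynO t; have [_ gauge] := halpha.
  rewrite OM OS !halphaq !gauge//.
  have [qh _ _] := hq; rewrite !(star_hom_Z qh) starZ -star_scalerAl -star_scalerAr scalerA.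
  have [psil _ _] := st_psi; rewrite (functionalZ psil) psi_weight//.
  have [<-|] := eqVneq x y; last by rewrite mul0r mulr0.
  set e := _ +i* _; have -> : e * e^* = 1; last by rewrite mul1r.
  rewrite /e; set th := t * _; apply/eqP; rewrite eq_complex /=.
  apply/andP; split; apply/eqP; first by rewrite mulrN opprK -!expr2 cos2Dsin2.
  by rewrite mulrN mulrC addNr.
- move=> x y xpos ypos; have [n nx] := BSpos_normal_form hd xpos.
  by rewrite (psiE n)// (normal_form_theta nx) -exprz_inv -exprnP exprVn.
- move=> ndc beta phi kms; have [st_phi _ _] := kms.
  split; first exact: (KMS_beta nicaTb cuntzTb kms).
  apply: (quotient_state_ext hc hd hT hq) => // x y xpos ypos.
  by rewrite [LHS](phi_monomial hc hd nicaTb cuntzTb kms)// [RHS]psi_weight.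
Qed.
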